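(* Let $c,\alpha,\beta\in(0,1)$. Let $\mathcal{D}$ be the set of all $f\in\mathcal{L}(c,\alpha,\beta)$ for which there exist an integer $t\ge1$ and $r>0$ such that $f^{t}(c_+)=c$ and $f^n(c_-)\notin(c,c+r)$ for all $n\in\mathbb{N}$. Then $\mathcal{D}$ is dense in $\mathcal{L}(c,\alpha,\beta)$ with respect to the metric $\operatorname{dist}$.
   Context: $\mathbb{N}=\{1,2,3,\dots\}$. $C^{1+}$ means $C^1$ with Hölder continuous derivative; a Hölder exponent $\rho\in(0,1)$ is fixed, $C^{1+}=C^{1+\rho}$ (locally, for maps on $[0,1]\setminus\{c\}$), and $\|\varphi\|_{C^{1+}}=\sup|\varphi|+\sup|\varphi'|+\sup_{x\ne y}\frac{|\varphi'(x)-\varphi'(y)|}{|x-y|^{\rho}}$. Expanding Lorenz map: for $0<c<1$, a $C^{1+}$ map $f:[0,1]\setminus\{c\}\to[0,1]$ such that $f(0)=0$, $f(1)=1$, there is a constant $\sigma>1$ with $f'(x)\ge\sigma$ for all $x\in[0,1]\setminus\{c\}$, and $f'(c_-)=f'(c_+)=+\infty$. The point $c$ is called the singularity. Here $f'(c_-)=\lim_{x\uparrow c}f'(x)$, $f'(c_+)=\lim_{x\downarrow c}f'(x)$, and for $n\ge1$, $f^n(c_-)=\lim_{x\uparrow c}f^n(x)$, $f^n(c_+)=\lim_{x\downarrow c}f^n(x)$. $\mathcal{L}(c,\alpha,\beta)$: the set of all expanding Lorenz maps $f$ with singularity $c$ for which there are $d_0,d_1\in[0,1]$ and $C^{1+}$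 diffeomorphisms $\phi_{0,f}:[0,c]\to[0,d_0^{1/\alpha}]$, $\phi_{1,f}:[c,1]\to[0,d_1^{1/\beta}]$ with $\phi_{0,f}(c)=\phi_{1,f}(c)=0$, $\phi_{0,f}(0)=d_0^{1/\alpha}$, $\phi_{1,f}(1)=d_1^{1/\beta}$, such that $f(x)=d_0-(\phi_{0,f}(x))^{\alpha}$ for $x<c$ and $f(x)=1-d_1+(\phi_{1,f}(x))^{\beta}$ for $x>c$ (so $f(c_-)=d_0$, $f(c_+)=1-d_1$). The metric is $$\operatorname{dist}(f,g)=|f(c_-)-g(c_-)|+|f(c_+)-g(c_+)|+\|\phi_{0,f}-\phi_{0,g}\|_{C^{1+}}+\|\phi_{1,f}-\phi_{1,g}\|_{C^{1+}}.$$ *)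

(* Defs.v *)
From HB Require Import structures.
From mathcomp Require Import all_boot all_order all_algebra.
From mathcomp Require Import all_classical all_reals all_analysis.

Set Implicit Arguments.
Unset Strict Implicit.
Unset Printing Implicit Defensive.
Import Order.TTheory GRing.Theory Num.Theory.
Import numFieldNormedType.Exports.

Local Open Scope classical_set_scope.
Local Open Scope ring_scope.

(* Maps defined on a subset A of the line are represented by total functions
   R -> R; their values outside A play no role. *)

(* Difference quotients are taken inside A, so that the derivative is one-sided
   at an endpoint of an interval. *)
Definition derivable_on (R : realType) (A : set R) (f : R -> R) (x : R) : Prop :=
  cvg ((fun y => (f y - f x) / (y - x)) @ within A x^').

Definition derive_on (R : realType) (A : set R) (f : R -> R) (x : R) : R :=
  lim ((fun y => (f y - f x) / (y - x)) @ within A x^').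

Definition holder_on (R : realType) (rho : R) (A : set R) (g : R -> R) : Prop :=
  exists K : R, forall x y, A x -> A y -> `|g x - g y| <= K * `|x - y| `^ rho.

Definition locally_holder_on (R : realType) (rho : R) (A : set R)
    (g : R -> R) : Prop :=
  forall x, A x -> exists K : R, \forall y & z \near nbhs x,
    A y -> A z -> `|g y - g z| <= K * `|y - z| `^ rho.

Definition C1holder_on (R : realType) (rho : R) (A : set R) (f : R -> R) : Prop :=
  (forall x, A x -> derivable_on A f x) /\ holder_on rho A (derive_on A f).

Definition locally_C1holder_on (R : realType) (rho : R) (A : set R)
    (f : R -> R) : Prop :=
  (forall x, A x -> derivable_on A f x) /\
  locally_holder_on rho A (derive_on A f).

Definition C1holder_diffeo (R : realType) (rho : R) (A B : set R)
    (phi : R -> R) : Prop :=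
  [/\ set_bij A B phi, C1holder_on rho A phi &
      exists psi : R -> R,
        (forall x, A x -> psi (phi x) = x) /\ C1holder_on rho B psi].

(* The suprema are taken in \bar R, hence the norm is +oo, and not a default
   real value, if one of the three quantities is unbounded. *)
Definition C1holder_norm (R : realType) (rho : R) (A : set R)
    (phi : R -> R) : \bar R :=
  (ereal_sup [set (`|phi x|)%:E | x in A] +
   ereal_sup [set (`|derive_on A phi x|)%:E | x in A] +
   ereal_sup [set (`|derive_on A phi p.1 - derive_on A phi p.2|
                   / `|p.1 - p.2| `^ rho)%:E
             | p in [set p : R * R | [/\ A p.1, A p.2 & p.1 != p.2]]])%E.

Definition lorenz_dom (R : realType) (c : R) : set R := `[0, 1] `\ c.

Definition expanding_lorenz (R : realType) (rho c : R) (f : R -> R) : Prop :=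
  let A := lorenz_dom c in
  [/\ forall x, A x -> 0 <= f x <= 1,
      locally_C1holder_on rho A f,
      f 0 = 0 /\ f 1 = 1,
      exists2 sigma : R, 1 < sigma & forall x, A x -> sigma <= derive_on A f x &
      derive_on A f x @[x --> c^'-] --> +oo /\
      derive_on A f x @[x --> c^'+] --> +oo].

(* f^n(c_-) and f^n(c_+).  An expanding Lorenz map is increasing on each side of
   c, so for x close to c on one side the points x, ..., f^(n-1) x avoid c: the
   limits exist and do not depend on the value of f at c. *)
Definition iter_left (R : realType) (c : R) (f : R -> R) (n : nat) : R :=
  lim (iter n f x @[x --> c^'-]).

Definition iter_right (R : realType) (c : R) (f : R -> R) (n : nat) : R :=
  lim (iter n f x @[x --> c^'+]).

Definition lorenz_charts (R : realType) (rho c alpha beta : R) (f : R -> R)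
    (phi : (R -> R) * (R -> R)) : Prop :=
  exists d0 d1 : R,
  [/\ 0 <= d0 <= 1 /\ 0 <= d1 <= 1,
      C1holder_diffeo rho `[0, c] `[0, d0 `^ alpha^-1] phi.1 /\
      C1holder_diffeo rho `[c, 1] `[0, d1 `^ beta^-1] phi.2,
      phi.1 c = 0 /\ phi.2 c = 0,
      phi.1 0 = d0 `^ alpha^-1 /\ phi.2 1 = d1 `^ beta^-1 &
      (forall x : R, 0 <= x < c -> f x = d0 - phi.1 x `^ alpha) /\
      (forall x : R, c < x <= 1 -> f x = 1 - d1 + phi.2 x `^ beta)].

Definition lorenz_maps (R : realType) (rho c alpha beta : R) : set (R -> R) :=
  [set f | expanding_lorenz rho c f /\
           exists phi, lorenz_charts rho c alpha beta f phi].

(* The pair (phi_{0,f}, phi_{1,f}).  Charts of f are unique on [0, c] and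
   [c, 1]: there phi_{0,f} = (f(c_-) - f)^(1/alpha) and
   phi_{1,f} = (f - f(c_+))^(1/beta) off c, and both vanish at c. *)
Definition charts (R : realType) (rho c alpha beta : R) (f : R -> R) :
    (R -> R) * (R -> R) :=
  xget (cst 0, cst 0) [set phi | lorenz_charts rho c alpha beta f phi].

Definition lorenz_dist (R : realType) (rho c alpha beta : R) (f g : R -> R) :
    \bar R :=
  let phi := charts rho c alpha beta f in
  let psi := charts rho c alpha beta g in
  let I0 : set R := `[0, c]%classic in
  let I1 : set R := `[c, 1]%classic in
  ((`|iter_left c f 1 - iter_left c g 1|)%:E +
   (`|iter_right c f 1 - iter_right c g 1|)%:E +
   C1holder_norm rho I0 (fun x => phi.1 x - psi.1 x)%R +
   C1holder_norm rho I1 (fun x => phi.2 x - psi.2 x)%R)%E.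

Definition lorenz_D (R : realType) (rho c alpha beta : R) : set (R -> R) :=
  [set f | lorenz_maps rho c alpha beta f /\
    exists (t : nat) (r : R),
    [/\ (1 <= t)%N, 0 < r, iter_right c f t = c &
        forall n : nat, (1 <= n)%N -> ~ (c < iter_left c f n < c + r)]].

(* Main.v *)
Require Import Defs.
From HB Require Import structures.
From mathcomp Require Import all_boot all_order all_algebra.
From mathcomp Require Import all_classical all_reals all_analysis.
From mathcomp Require Import ring lra.

(** Both one-sided orbits of the singularity can be made periodic by an
    arbitrarily small perturbation, one side at a time.

    Perturbing one branch.  Consider the right branch
    [f x = 1 - d1 + phi x `^ beta].  Choose a function [m >= 0] of the chart
    coordinate with [m 0 = 1] and [m = 0] at the right endpoint [phi 1] and at
    finitely many prescribed points, and put [f_s = f + s * m (phi x)] to the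
    right of [c].  Then [f_s 1 = 1], [f_s] is nondecreasing in [s], and
    [f_s(c_+) = f(c_+) + s].  If [1 - m u = u `^ beta * q u] with [q] of class
    [C^{1+rho}], the new chart is
    [phi * (1 - s * q phi) `^ beta^-1], which tends to [phi] in the
    [C^{1+rho}] norm as [s] tends to 0 ([exists_bump], [perturb_chart]); for
    small [s] the map [f_s] is still expanding ([expanding_lorenz_perturb]).

    Hitting the singularity.  As long as the orbits of [f_s(c_+)] and
    [f_s'(c_+)] stay on the same side of [c], their distance is at least
    [sigma ^+ n * (s - s')]: the map is expanding and monotone in the parameter.
    If the orbit of [f_s(c_+)] never met [c], it would depend continuously on
    [s], hence the orbits for two parameters would stay on the same side for
    ever by the intermediate value theorem, and would separate by more than 1
    ([exists_param_hits_right]).  Hence arbitrarily small [s] give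
    [f_s^t(c_+) = c].

    Conclusion.  The mirror image of this argument on the left branch makes
    [c_-] periodic ([perturb_left]).  The right branch is then perturbed with
    [m] vanishing at the finitely many points of the orbit of [c_-], which is
    therefore unchanged, so that [c_+] becomes periodic as well
    ([perturb_right]).  A finite orbit misses some interval [(c, c + r)].

    The estimates in [C^{1+rho}] are made through the predicate [C1bound], which
    replaces derivatives by a first-order Taylor estimate and is stable under
    sums, products, composition and inversion by elementary algebra. *)

Set Implicit Arguments.
Unset Strict Implicit.
Unset Printing Implicit Defensive.
Import Order.TTheory GRing.Theory Num.Theory.
Import numFieldNormedType.Exports.

Local Open Scope classical_set_scope.
Local Open Scope ring_scope.

(** * Functions with a Hoelder first-order Taylor estimate *)

(** [C1bound rho A f f' B]: on [A] the function [f], its derivative [f'] and the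
    [rho]-Hoelder Taylor remainder of [f] are bounded by the one constant [B].
    On an interval this amounts, up to the value of [B], to a bound on the
    [C^{1+rho}] norm of [f].  The factor [|y - x|^{1+rho}] is split so that
    [y = x] needs no special treatment. *)
Definition C1bound (R : realType) (rho : R) (A : set R) (f f' : R -> R)
    (B : R) : Prop :=
  [/\ forall x, A x -> `|f x| <= B,
      forall x, A x -> `|f' x| <= B &
      forall x y, A x -> A y ->
        `|f y - f x - f' x * (y - x)| <= B * (`|y - x| * `|y - x| `^ rho)].

(** Sets of diameter at most 1. *)
Definition diam1 (R : realType) (A : set R) : Prop :=
  forall x y, A x -> A y -> `|y - x| <= 1.

Lemma powR_le1 (R : realType) (rho a : R) :
  0 < rho -> 0 <= a <= 1 -> 0 <= a `^ rho <= 1.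
Proof.
move=> r0 /andP[a0 a1]; rewrite powR_ge0 /= -[leRHS](congr1 (@^~ rho) (@powR1 R)).
by rewrite ge0_ler_powR ?nnegrE// ltW.
Qed.

Lemma C1bound_ge0 (R : realType) (rho : R) (A : set R) f f' B x :
  A x -> C1bound rho A f f' B -> 0 <= B.
Proof. by move=> Ax [h _ _]; exact: le_trans (normr_ge0 _) (h _ Ax). Qed.

Lemma C1bound_le (R : realType) (rho : R) (A : set R) f f' B C :
  B <= C -> C1bound rho A f f' B -> C1bound rho A f f' C.
Proof.
move=> BC [h1 h2 h3]; split => [x /h1|x /h2|x y Ax Ay].
- by move/le_trans; apply.
- by move/le_trans; apply.
- apply: le_trans (h3 _ _ Ax Ay) _; by rewrite ler_wpM2r.
Qed.

Lemma C1bound_ext (R : realType) (rho : R) (A : set R) f g f' g' B :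
  (forall x, A x -> f x = g x) -> (forall x, A x -> f' x = g' x) ->
  C1bound rho A f f' B -> C1bound rho A g g' B.
Proof.
move=> fg fg' [h1 h2 h3]; split => [x Ax|x Ax|x y Ax Ay].
- by rewrite -fg ?h1.
- by rewrite -fg' ?h2.
- by rewrite -!fg -?fg' ?h3.
Qed.

Lemma C1bound_lip (R : realType) (rho : R) (A : set R) f f' B x y :
  0 < rho -> diam1 A -> C1bound rho A f f' B -> A x -> A y ->
  `|f y - f x| <= 2 * B * `|y - x|.
Proof.
move=> r0 dA fB Ax Ay; have B0 := C1bound_ge0 Ax fB.
case: fB => _ h2 h3.
have /andP[p0 p1] : 0 <= `|y - x| `^ rho <= 1.
  by apply: powR_le1; rewrite // normr_ge0 dA.
rewrite -[X in `|X|](subrK (f' x * (y - x))).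
apply: le_trans (ler_normD _ _) _.
rewrite [leRHS](_ : _ = B * (`|y - x| * 1) + B * `|y - x|); last by ring.
apply: lerD.
  apply: le_trans (h3 _ _ Ax Ay) _; rewrite ler_wpM2l// ler_wpM2l//.
by rewrite normrM ler_wpM2r ?h2.
Qed.

Lemma C1bound_cst (R : realType) (rho : R) (A : set R) (a : R) :
  C1bound rho A (fun=> a) (fun=> 0) `|a|.
Proof.
split=> [//|x _|x y _ _]; first by rewrite normr0.
by rewrite subrr mul0r subr0 normr0 !mulr_ge0 ?powR_ge0.
Qed.

Lemma C1boundD (R : realType) (rho : R) (A : set R) f f' g g' B C :
  C1bound rho A f f' B -> C1bound rho A g g' C ->
  C1bound rho A (fun x => f x + g x) (fun x => f' x + g' x) (B + C).
Proof.
move=> [f1 f2 f3] [g1 g2 g3]; split => [x Ax|x Ax|x y Ax Ay].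
- by apply: le_trans (ler_normD _ _) _; rewrite lerD ?f1 ?g1.
- by apply: le_trans (ler_normD _ _) _; rewrite lerD ?f2 ?g2.
- rewrite [X in `|X|](_ : _ = (f y - f x - f' x * (y - x)) +
    (g y - g x - g' x * (y - x))); last by ring.
  by apply: le_trans (ler_normD _ _) _; rewrite mulrDl lerD ?f3 ?g3.
Qed.

Lemma C1boundZ (R : realType) (rho : R) (A : set R) f f' B a :
  C1bound rho A f f' B ->
  C1bound rho A (fun x => a * f x) (fun x => a * f' x) (`|a| * B).
Proof.
move=> [f1 f2 f3]; split => [x Ax|x Ax|x y Ax Ay].
- by rewrite normrM ler_wpM2l ?f1.
- by rewrite normrM ler_wpM2l ?f2.
- by rewrite -mulrBr -mulrA -mulrBr normrM -mulrA ler_wpM2l ?f3.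
Qed.

Lemma C1boundM (R : realType) (rho : R) (A : set R) f f' g g' B C :
  0 < rho <= 1 -> diam1 A ->
  C1bound rho A f f' B -> C1bound rho A g g' C ->
  C1bound rho A (fun x => f x * g x) (fun x => f' x * g x + f x * g' x)
    (6 * B * C).
Proof.
move=> /andP[r0 r1] dA fB gC; have := fB; have := gC.
move=> [g1 g2 g3] [f1 f2 f3].
split => [x Ax|x Ax|x y Ax Ay]; have B0 := C1bound_ge0 Ax fB;
    have C0 := C1bound_ge0 Ax gC; have BC0 := mulr_ge0 B0 C0.
- rewrite normrM; apply: le_trans (ler_pM _ _ (f1 _ Ax) (g1 _ Ax)) _ => //.
  by rewrite -mulrA ler_peMl// ler1n.
- apply: le_trans (ler_normD _ _) _; rewrite !normrM.
  apply: (@le_trans _ _ (B * C + B * C)).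
    by rewrite lerD// ler_pM ?f1 ?f2 ?g1 ?g2.
  by rewrite -mulrA; lra.
- set d := `|y - x|; have d0 : 0 <= d by exact: normr_ge0.
  have d1 : d <= 1 by exact: dA.
  have dd : d <= d `^ rho.
    have [->|dn0] := eqVneq d 0; first by exact: powR_ge0.
    by apply: ger1_powR; rewrite // lt0r dn0 d0.
  rewrite [X in `|X|](_ : _ = (f y - f x - f' x * (y - x)) * g x +
    f x * (g y - g x - g' x * (y - x)) + (f y - f x) * (g y - g x)); last by ring.
  apply: le_trans (ler_normD _ _) _.
  apply: le_trans (lerD (ler_normD _ _) (lexx _)) _; rewrite !normrM.
  have e1 := ler_pM (normr_ge0 _) (normr_ge0 _) (f3 _ _ Ax Ay) (g1 _ Ax).
  have e2 := ler_pM (normr_ge0 _) (normr_ge0 _) (f1 _ Ax) (g3 _ _ Ax Ay).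
  have e3 := ler_pM (normr_ge0 _) (normr_ge0 _) (C1bound_lip r0 dA fB Ax Ay)
    (C1bound_lip r0 dA gC Ax Ay).
  apply: le_trans (lerD (lerD e1 e2) e3) _; rewrite -/d.
  rewrite [leLHS](_ : _ = 2 * (B * C) * (d * d `^ rho) + 4 * (B * C) * (d * d)); last by ring.
  rewrite [leRHS](_ : _ = 2 * (B * C) * (d * d `^ rho) + 4 * (B * C) * (d * d `^ rho)); last by ring.
  by rewrite lerD2l ler_wpM2l ?mulr_ge0// ler_wpM2l.
Qed.

(** The bound is linear in the bound [C] of the outer function. *)
Lemma C1bound_comp (R : realType) (rho : R) (A A' : set R) f f' k k' B C :
  0 < rho -> diam1 A -> (forall x, A x -> A' (f x)) ->
  C1bound rho A f f' B -> C1bound rho A' k k' C ->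
  C1bound rho A (fun x => k (f x)) (fun x => k' (f x) * f' x)
    (C * (1 + B + 2 * B * (2 * B) `^ rho)).
Proof.
move=> r0 dA AA' fB kC; have := fB; have := kC.
move=> [k1 k2 k3] [f1 f2 f3].
split => [x Ax|x Ax|x y Ax Ay]; have B0 := C1bound_ge0 Ax fB;
    have C0 := C1bound_ge0 (AA' _ Ax) kC;
    have p0 : 0 <= 2 * B * (2 * B) `^ rho by rewrite !mulr_ge0 ?powR_ge0.
- apply: le_trans (k1 _ (AA' _ Ax)) _; rewrite ler_peMr//; lra.
- rewrite normrM; apply: le_trans (ler_pM _ _ (k2 _ (AA' _ Ax)) (f2 _ Ax)) _ => //.
  by rewrite ler_wpM2l//; lra.
- set d := `|y - x|; have d0 : 0 <= d by exact: normr_ge0.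
  rewrite [X in `|X|](_ : _ = (k (f y) - k (f x) - k' (f x) * (f y - f x)) +
    k' (f x) * (f y - f x - f' x * (y - x))); last by ring.
  apply: le_trans (ler_normD _ _) _; rewrite normrM.
  have lp := C1bound_lip r0 dA fB Ax Ay.
  have e1 : `|k (f y) - k (f x) - k' (f x) * (f y - f x)| <=
      C * ((2 * B) * (2 * B) `^ rho * (d * d `^ rho)).
    apply: le_trans (k3 _ _ (AA' _ Ax) (AA' _ Ay)) _; rewrite ler_wpM2l//.
    rewrite mulrACA -powRM ?mulr_ge0//.
    apply: ler_pM; rewrite ?powR_ge0//.
    by rewrite ge0_ler_powR ?nnegrE ?mulr_ge0// ltW.
  have e2 := ler_pM (normr_ge0 _) (normr_ge0 _) (k2 _ (AA' _ Ax)) (f3 _ _ Ax Ay).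
  apply: le_trans (lerD e1 e2) _; rewrite -/d.
  have dp0 : 0 <= d * d `^ rho by rewrite mulr_ge0 ?powR_ge0.
  rewrite -[leRHS]mulrA -mulrDr ler_wpM2l// -mulrDl ler_wpM2r//; lra.
Qed.

(** If the outer function vanishes at 0 and the inner one is small, the bound is
    also linear in the bound [B] of the inner function. *)
Lemma C1bound_comp0 (R : realType) (rho : R) (A A' : set R) f f' k k' B C :
  0 < rho -> diam1 A -> diam1 A' -> A' 0 -> k 0 = 0 ->
  (forall x, A x -> A' (f x)) -> 2 * B <= 1 ->
  C1bound rho A f f' B -> C1bound rho A' k k' C ->
  C1bound rho A (fun x => k (f x)) (fun x => k' (f x) * f' x) (3 * C * B).
Proof.
move=> r0 dA dA' A0 k0 AA' Bs fB kC; have := fB; have := kC.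
move=> [k1 k2 k3] [f1 f2 f3].
split => [x Ax|x Ax|x y Ax Ay]; have B0 := C1bound_ge0 Ax fB;
    have C0 := C1bound_ge0 (AA' _ Ax) kC; have BC0 := mulr_ge0 C0 B0.
- have := C1bound_lip r0 dA' kC A0 (AA' _ Ax); rewrite k0 !subr0 => /le_trans.
  apply; rewrite -!mulrA (le_trans (y := 2 * (C * B)))//; last by lra.
  by rewrite ler_wpM2l// ler_wpM2l// f1.
- rewrite normrM; apply: le_trans (ler_pM _ _ (k2 _ (AA' _ Ax)) (f2 _ Ax)) _ => //.
  by rewrite -mulrA; lra.
- set d := `|y - x|; have d0 : 0 <= d by exact: normr_ge0.
  rewrite [X in `|X|](_ : _ = (k (f y) - k (f x) - k' (f x) * (f y - f x)) +
    k' (f x) * (f y - f x - f' x * (y - x))); last by ring.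
  apply: le_trans (ler_normD _ _) _; rewrite normrM.
  have lp := C1bound_lip r0 dA fB Ax Ay.
  have e1 : `|k (f y) - k (f x) - k' (f x) * (f y - f x)| <=
      C * ((2 * B) * (d * d `^ rho)).
    apply: le_trans (k3 _ _ (AA' _ Ax) (AA' _ Ay)) _; rewrite ler_wpM2l//.
    rewrite mulrA; apply: ler_pM; rewrite ?powR_ge0//.
    rewrite ge0_ler_powR ?nnegrE ?mulr_ge0// ?(ltW r0)//.
    by apply: le_trans lp _; rewrite ler_piMl.
  have e2 := ler_pM (normr_ge0 _) (normr_ge0 _) (k2 _ (AA' _ Ax)) (f3 _ _ Ax Ay).
  apply: le_trans (lerD e1 e2) _; rewrite -/d.
  have dp0 : 0 <= d * d `^ rho by rewrite mulr_ge0 ?powR_ge0.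
  by rewrite [leRHS](_ : _ = C * (2 * B * (d * d `^ rho)) + C * (B * (d * d `^ rho)))//; ring.
Qed.

(** * Power functions *)

(** The mean value theorem between [x] and [y] in either order. *)
Lemma MVT_itv (R : realType) (f f' : R -> R) (a b x y : R) :
  {within `[a, b], continuous f} ->
  (forall z, a < z < b -> is_derive z 1 f (f' z)) ->
  a <= x <= b -> a <= y <= b ->
  exists2 z, a <= z <= b /\ `|z - x| <= `|y - x| & f y - f x = f' z * (y - x).
Proof.
move=> fc fd.
have H u v : a <= u <= b -> a <= v <= b -> u < v ->
    exists2 z, u < z < v & f v - f u = f' z * (v - u).
  move=> /andP[au ub] /andP[av vb] uv.
  have [||z zuv ->] := @MVT R f f' u v uv.
  - move=> z; rewrite in_itv /= => /andP[uz zv]; apply: fd.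
    by rewrite (le_lt_trans au uz) (lt_le_trans zv vb).
  - apply: continuous_subspaceW fc => z /=; rewrite !in_itv/= => /andP[uz zv].
    by rewrite (le_trans au uz) (le_trans zv vb).
  by exists z => //; move: zuv; rewrite in_itv.
move=> xab yab; have [xy|yx|->] := ltgtP x y.
- have [z /andP[xz zy] e] := H _ _ xab yab xy; exists z => //; split.
    by case/andP: xab yab => ? ? /andP[? ?]; apply/andP; split; lra.
  by rewrite !ger0_norm; lra.
- have [z /andP[yz zx] e] := H _ _ yab xab yx; exists z.
    split; first by case/andP: xab yab => ? ? /andP[? ?]; apply/andP; split; lra.
    by rewrite !ler0_norm; lra.
  by rewrite -[RHS]opprK -mulrN opprB -e opprB.
- by exists y; rewrite ?subrr ?mulr0// lexx.
Qed.

Lemma C1bound_lipschitz_derive (R : realType) (rho : R) (f f' : R -> R)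
    (a b L : R) : 0 < rho <= 1 -> a <= b <= a + 1 ->
  {within `[a, b], continuous f} ->
  (forall z, a < z < b -> is_derive z 1 f (f' z)) ->
  (forall x y, a <= x <= b -> a <= y <= b -> `|f' y - f' x| <= L * `|y - x|) ->
  exists B, C1bound rho `[a, b] f f' B.
Proof.
move=> /andP[r0 r1] /andP[ab ba] fc fd fL.
have aab : a <= a <= b by rewrite lexx.
have dist1 x y : a <= x <= b -> a <= y <= b -> `|y - x| <= 1.
  by move=> /andP[? ?] /andP[? ?]; rewrite ler_norml; apply/andP; split; lra.
have f'b x : a <= x <= b -> `|f' x| <= `|f' a| + `|L|.
  move=> xab; rewrite -[f' x](subrK (f' a)) addrC.
  apply: le_trans (ler_normD _ _) _; rewrite lerD2l.
  apply: le_trans (fL _ _ aab xab) _.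
  apply: le_trans (ler_norm _) _; rewrite normrM normr_id.
  by rewrite ler_piMr// dist1.
exists (`|f a| + `|f' a| + `|L|); split => [x|x|x y]; rewrite /= !in_itv/=.
- move=> xab; have [z [zab _] e] := MVT_itv fc fd aab xab.
  rewrite -[f x](subrK (f a)) addrC -addrA e.
  apply: le_trans (ler_normD _ _) _; rewrite lerD2l normrM.
  apply: (@le_trans _ _ `|f' z|); first by rewrite ler_piMr// dist1.
  exact: f'b.
- by move=> /f'b /le_trans; apply; rewrite lerD2r ler_wpDl.
- move=> xab yab; have [z [zab zx] e] := MVT_itv fc fd xab yab.
  rewrite e -mulrBl normrM.
  apply: (@le_trans _ _ (`|L| * (`|y - x| * `|y - x|))).
    rewrite mulrA ler_wpM2r//; apply: le_trans (fL _ _ xab zab) _.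
    apply: (@le_trans _ _ (`|L| * `|z - x|)); first by rewrite ler_wpM2r ?ler_norm.
    by rewrite ler_wpM2l.
  apply: (@le_trans _ _ (`|L| * (`|y - x| * `|y - x| `^ rho))).
    rewrite ler_wpM2l// ler_wpM2l//.
    have [->|dn0] := eqVneq `|y - x| 0; first by exact: powR_ge0.
    by apply: ger1_powR; rewrite // lt0r dn0 normr_ge0 dist1.
  by rewrite ler_wpM2r ?mulr_ge0 ?powR_ge0// ler_wpDl ?addr_ge0.
Qed.

Lemma within_continuous_powR (R : realType) (p a b : R) : 0 < p -> 0 <= a < b ->
  {within `[a, b], continuous (fun u : R => u `^ p)}.
Proof.
move=> p0 /andP[a0 ab].
have pc u : 0 < u -> {for u, continuous (fun u : R => u `^ p)}.
  move=> u0; apply: differentiable_continuous.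
  by apply/derivable1_diffP; apply: derivable_powR; rewrite in_itv/= u0.
apply/continuous_within_itvP => //; split.
- by move=> u; rewrite in_itv/= => /andP[au _]; apply: pc; exact: le_lt_trans au.
- have [->|an0] := eqVneq a 0.
    by rewrite powR0 ?gt_eqF//; exact: powR_cvg0.
  by apply: cvg_at_right_filter; apply: pc; rewrite lt0r an0.
- by apply: cvg_at_left_filter; apply: pc; exact: le_lt_trans ab.
Qed.

(** The derivative of [u `^ p] is Lipschitz on [[a, b]] if [p >= 2], or if the
    interval stays away from 0. *)
Lemma C1bound_powR (R : realType) (rho p a b : R) : 0 < rho <= 1 ->
  0 <= a < b -> b <= a + 1 -> 1 < p -> (2 <= p) || (0 < a) ->
  exists B, C1bound rho `[a, b] (fun u => u `^ p) (fun u => p * u `^ (p - 1)) B.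
Proof.
move=> r01 /andP[a0 ab] ba p1 pa.
have p0 : 0 < p by exact: lt_trans p1.
have pm0 : 0 < p - 1 by rewrite subr_gt0.
pose M := (p - 1) * (Num.max (b `^ (p - 2)) (a `^ (p - 2))).
have M0 : 0 <= M by rewrite mulr_ge0 ?(ltW pm0)// le_max powR_ge0.
apply: (@C1bound_lipschitz_derive _ _ _ _ a b (p * M)) => //.
- by rewrite (ltW ab).
- by apply: within_continuous_powR; rewrite ?a0.
- move=> z /andP[az zb]; apply: is_derive1_powR; exact: le_lt_trans az.
- move=> x y xab yab.
  have [||z [zab _] e] := @MVT_itv R (fun u => u `^ (p - 1))
    (fun u => if u == a then 0 else (p - 1) * u `^ (p - 1 - 1)) a b x y _ _ xab yab.
  - by apply: within_continuous_powR; rewrite ?a0.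
  - move=> z /andP[az zb]; rewrite gt_eqF//; apply: is_derive1_powR.
    exact: le_lt_trans az.
  rewrite -mulrBr e !normrM (gtr0_norm p0) mulrA ler_wpM2r// ler_wpM2l ?(ltW p0)//.
  case: ifPn => [_|zna]; first by rewrite normr0.
  have az : a < z by rewrite lt_neqAle eq_sym zna; case/andP: zab.
  have z0 : 0 < z by exact: le_lt_trans az.
  rewrite ger0_norm; last by rewrite mulr_ge0 ?powR_ge0// ltW.
  rewrite ler_wpM2l ?(ltW pm0)// le_max.
  rewrite (_ : p - 1 - 1 = p - 2); last by ring.
  have [p2|p2] := leP 2 p.
    apply/orP; left; rewrite ge0_ler_powR ?nnegrE ?subr_ge0 ?(ltW z0)//.
      by rewrite (le_trans a0 (ltW ab)).
    by case/andP: zab.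
  have {}a0 : 0 < a by move: pa; rewrite leNgt p2.
  apply/orP; right; rewrite -(opprB 2 p) !powRN lef_pV2 ?posrE ?powR_gt0//.
  by rewrite ge0_ler_powR ?nnegrE ?opprB ?subr_ge0 ?(ltW z0) ?(ltW a0)// ltW.
Qed.

(** * The bump and the perturbation of a power *)

(** [C1bound] for some derivative and some constant. *)
Definition C1bounded (R : realType) (rho : R) (A : set R) (f : R -> R) : Prop :=
  exists f' B, C1bound rho A f f' B.

Lemma diam1_itv (R : realType) (a b : R) : b <= a + 1 -> diam1 `[a, b].
Proof.
move=> ba x y /=; rewrite !in_itv/= => /andP[? ?] /andP[? ?].
by rewrite ler_norml; apply/andP; split; lra.
Qed.

Lemma C1bounded_cst (R : realType) (rho : R) (A : set R) (a : R) :
  C1bounded rho A (fun=> a).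
Proof. by exists (fun=> 0), `|a|; exact: C1bound_cst. Qed.

Lemma C1boundedD (R : realType) (rho : R) (A : set R) f g :
  C1bounded rho A f -> C1bounded rho A g -> C1bounded rho A (fun x => f x + g x).
Proof. by move=> [? [? h]] [? [? k]]; do 2 eexists; exact: (C1boundD h k). Qed.

Lemma C1boundedZ (R : realType) (rho : R) (A : set R) f a :
  C1bounded rho A f -> C1bounded rho A (fun x => a * f x).
Proof. by move=> [? [? h]]; do 2 eexists; exact: (C1boundZ a h). Qed.

Lemma C1boundedM (R : realType) (rho : R) (A : set R) f g :
  0 < rho <= 1 -> diam1 A ->
  C1bounded rho A f -> C1bounded rho A g -> C1bounded rho A (fun x => f x * g x).
Proof.
by move=> r dA [? [? h]] [? [? k]]; do 2 eexists; exact: (C1boundM r dA h k).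
Qed.

Lemma C1bounded_comp (R : realType) (rho : R) (A A' : set R) f k :
  0 < rho -> diam1 A -> (forall x, A x -> A' (f x)) ->
  C1bounded rho A f -> C1bounded rho A' k -> C1bounded rho A (fun x => k (f x)).
Proof.
move=> r dA AA' [? [? h]] [? [? k']]; do 2 eexists.
exact: (C1bound_comp r dA AA' h k').
Qed.

Lemma C1bound_id (R : realType) (rho : R) :
  C1bound rho `[0, 1] (fun u : R => u) (fun=> 1) 1.
Proof.
split=> [x|x _|x y _ _]; first by rewrite /= in_itv/= => /andP[? ?]; rewrite ger0_norm.
  by rewrite normr1.
by rewrite mul1r subrr normr0 !mulr_ge0 ?powR_ge0.
Qed.

Lemma C1bounded_powR (R : realType) (rho p : R) : 0 < rho <= 1 -> 2 <= p ->
  C1bounded rho `[0, 1] (fun u => u `^ p).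
Proof.
move=> r p2; have [||||B hB] := @C1bound_powR R rho p 0 1 r; rewrite ?p2 ?lexx ?add0r ?ltr01//.
- by rewrite (lt_le_trans _ p2)// ltr1n.
by do 2 eexists; exact: hB.
Qed.

(** The bump is [m = 1 - r]: it is nonnegative, equals 1 at 0 and vanishes on
    [L].  The quotient [q] of [r] by [u `^ beta] is still of class [C^{1+rho}] up
    to 0.  Explicitly, [m] is the product over [w] in [L] of
    [(1 - (u / w) `^ (2 + beta)) ^+ 2]. *)
Lemma exists_bump (R : realType) (rho beta : R) (L : seq R) :
  0 < rho <= 1 -> 0 < beta -> (forall w, w \in L -> 0 < w) ->
  exists q r : R -> R,
  [/\ C1bounded rho `[0, 1] q, C1bounded rho `[0, 1] r,
      forall u : R, 0 <= u -> r u = u `^ beta * q u,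
      forall u, r u <= 1 &
      forall w, w \in L -> r w = 1].
Proof.
move=> r01 b0; elim: L => [_|w L IH wL].
  exists (fun=> 0), (fun=> 0); split => [||u _|u|w] //.
  - exact: C1bounded_cst.
  - exact: C1bounded_cst.
  - by rewrite mulr0.
have [|q [r [hq hr rq r1 rL]]] := IH.
  by move=> v vL; apply: wL; rewrite in_cons vL orbT.
have w0 : 0 < w by apply: wL; rewrite mem_head.
have d1 : diam1 `[(0:R), 1] by apply: diam1_itv; rewrite add0r.
pose A := (w `^ (2 + beta))^-1.
pose rw u : R := 2 * A * u `^ (2 + beta) + - A ^+ 2 * u `^ (2 + beta + (2 + beta)).
(* [1 - rw] is the new factor of the bump; [tw] is [rw] divided by [u `^ beta] *)
pose tw u : R := 2 * A * u `^ 2 + - A ^+ 2 * u `^ (2 + beta + 2).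
have rwE u : 1 - rw u = (1 - A * u `^ (2 + beta)) ^+ 2.
  by rewrite /rw (@powRD _ u (2 + beta) (2 + beta)); [ring | rewrite gt_eqF//; lra].
have rwtw u : 0 <= u -> rw u = u `^ beta * tw u.
  move=> u0; rewrite /rw /tw.
  have -> : u `^ (2 + beta) = u `^ beta * u `^ 2.
    by rewrite mulrC powRD// gt_eqF//; lra.
  have -> : u `^ (2 + beta + (2 + beta)) = u `^ beta * u `^ (2 + beta + 2).
    by rewrite -powRD; [congr powR; ring | rewrite gt_eqF//; lra].
  by ring.
have hrw : C1bounded rho `[0, 1] rw.
  by apply: C1boundedD; apply: C1boundedZ; apply: C1bounded_powR => //; lra.
have htw : C1bounded rho `[0, 1] tw.
  by apply: C1boundedD; apply: C1boundedZ; apply: C1bounded_powR => //; lra.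
(* the new [r] satisfies [1 - r = (1 - r_old) * (1 - rw)] *)
exists (fun u => q u + tw u + -1 * (q u * rw u)).
exists (fun u => r u + rw u + -1 * (r u * rw u)); split.
- by apply: (C1boundedD (C1boundedD hq htw)); apply: C1boundedZ; exact: C1boundedM.
- by apply: (C1boundedD (C1boundedD hr hrw)); apply: C1boundedZ; exact: C1boundedM.
- by move=> u u0; rewrite rq// rwtw//; ring.
- move=> u; rewrite -subr_ge0.
  rewrite (_ : _ - _ = (1 - r u) * (1 - rw u)); last by ring.
  by rewrite mulr_ge0 ?rwE ?sqr_ge0 ?subr_ge0.
- move=> v; rewrite in_cons => /orP[/eqP->|vL].
    have -> : rw w = 1.
      apply/eqP; rewrite eq_sym -subr_eq0 rwE /A mulVf ?subrr ?expr0n//.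
      by rewrite gt_eqF// powR_gt0.
    by ring.
  by rewrite rL//; ring.
Qed.

(** The map [u * (1 - s * q u) `^ gamma] is within [s * C] of the identity in
    [C^{1+rho}]. *)
Lemma C1bound_powR_perturb (R : realType) (rho gamma : R) q :
  0 < rho <= 1 -> 1 < gamma -> C1bounded rho `[0, 1] q ->
  exists C s0 : R, [/\ 0 <= C, 0 < s0 & forall s : R, 0 <= s <= s0 ->
    (forall u : R, 0 <= u <= 1 -> 2^-1 <= 1 - s * q u) /\
    exists k', C1bound rho `[0, 1] (fun u => u * ((1 - s * q u) `^ gamma - 1))
      k' (s * C)].
Proof.
move=> r01 g1 [q' [B hq]].
have d01 : diam1 `[(0:R), 1] by apply: diam1_itv; rewrite add0r.
have dm : diam1 `[- 2^-1 : R, 2^-1] by apply: diam1_itv; lra.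
have r0 : 0 < rho by case/andP: r01.
have B0 : 0 <= B by apply: (@C1bound_ge0 _ rho `[0, 1] q q' B 0); rewrite //= in_itv/= lexx ler01.
have [P' [BP hP]] : C1bounded rho `[- 2^-1 : R, 2^-1]
    (fun z => (1 + -1 * z) `^ gamma + -1).
  apply: C1boundedD; last exact: C1bounded_cst.
  apply: (@C1bounded_comp _ _ _ `[2^-1, 2^-1 + 1] (fun z => 1 + -1 * z)
      (fun w => w `^ gamma)) => //.
  - by move=> x /=; rewrite !in_itv/= => /andP[? ?]; apply/andP; split; lra.
  - apply: C1boundedD; first exact: C1bounded_cst.
    apply: C1boundedZ; exists (fun=> 1), 1; split=> [x|x _|x y _ _].
    + by rewrite /= in_itv/= => /andP[? ?]; rewrite ler_norml; apply/andP; split; lra.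
    + by rewrite normr1.
    + by rewrite mul1r subrr normr0 !mulr_ge0 ?powR_ge0.
  - have [|||| B' hB'] := @C1bound_powR R rho gamma 2^-1 (2^-1 + 1) r01.
    + by apply/andP; split; lra.
    + by [].
    + by [].
    + by rewrite invr_gt0 ltr0n orbT.
    by do 2 eexists; exact: hB'.
have BP0 : 0 <= BP.
  apply: (@C1bound_ge0 _ rho _ _ P' BP 0 _ hP); rewrite /= in_itv/=; apply/andP; split; lra.
have B1 : 0 < 2 * (B + 1) by lra.
exists (18 * BP * B), (2 * (B + 1))^-1; split; rewrite ?mulr_ge0 ?invr_gt0// => s /andP[s0 sB].
have sB2 : s * B <= 2^-1.
  have e : s * (2 * (B + 1)) <= 1 by rewrite -ler_pdivlMr// mul1r.
  have := mulr_ge0 s0 B0; lra.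
have sq u : 0 <= u <= 1 -> `|s * q u| <= 2^-1.
  move=> u01; rewrite normrM (ger0_norm s0); apply: le_trans sB2.
  by rewrite ler_wpM2l//; case: hq => + _ _; apply; rewrite /= in_itv.
split => [u /sq|].
  by rewrite ler_norml => /andP[? ?]; lra.
have hsq := C1boundZ s hq.
have k0 : (1 + -1 * 0) `^ gamma + -1 = 0 :> R.
  by rewrite mulr0 addr0 powR1 subrr.
have [|||h h2 h3] := C1bound_comp0 r0 d01 dm _ k0 _ _ hsq hP.
- by rewrite /= in_itv/=; apply/andP; split; lra.
- by move=> x; rewrite /= !in_itv/= => /sq; rewrite ler_norml.
- by rewrite (ger0_norm s0); lra.
have := C1boundM r01 d01 (C1bound_id rho) (And3 h h2 h3).
set D := 6 * _ * _; have -> : D = s * (18 * BP * B) by rewrite /D (ger0_norm s0); ring.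
move=> hh; eexists; apply: C1bound_ext hh => [x _|x _]; last by reflexivity.
by rewrite /= mulN1r.
Qed.

(** * The Taylor estimate and one-sided derivatives *)

Lemma within_dnbhs_proper (R : realType) (A : set R) (a b x : R) :
  a < b -> a <= x <= b -> (`[a, b] `<=` A) -> ProperFilter (within A x^').
Proof.
move=> ab /andP[ax xb] sA; split => [[e /= e0 he]|]; last exact: within_filter.
have [y [yx yA yd]] : exists y, [/\ y != x, A y & `|x - y| < e].
  have [xb'|] := ltP x b.
    pose d := Num.min (e / 2) (b - x).
    have d0 : 0 < d by rewrite lt_min divr_gt0// subr_gt0.
    have d1 : d <= e / 2 by rewrite ge_min lexx.
    have d2 : d <= b - x by rewrite ge_min lexx orbT.
    exists (x + d); split; first by rewrite -subr_eq0 addrC addKr gt_eqF.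
      by apply: sA; rewrite /= in_itv/=; apply/andP; split; lra.
    by rewrite opprD addrA subrr sub0r normrN gtr0_norm//; lra.
  move=> bx; have {bx xb}-> : x = b by apply/eqP; rewrite eq_le xb.
  pose d := Num.min (e / 2) (b - a).
  have d0 : 0 < d by rewrite lt_min divr_gt0// subr_gt0.
  have d1 : d <= e / 2 by rewrite ge_min lexx.
  have d2 : d <= b - a by rewrite ge_min lexx orbT.
  exists (b - d); split; first by rewrite -subr_eq0 addrC addKr oppr_eq0 gt_eqF.
    by apply: sA; rewrite /= in_itv/=; apply/andP; split; lra.
  by rewrite opprB addrC subrK gtr0_norm//; lra.
exact: (he y).
Qed.

Lemma within_dnbhsW (R : realType) (A : set R) (x : R) (P : set R) :
  (\forall y \near x, A y -> y != x -> P y) -> within A x^' P.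
Proof. by apply: filterS => y h yx Ay; exact: h. Qed.

Lemma powR_small (R : realType) (rho e : R) : 0 < rho -> 0 < e ->
  \forall d \near (0 : R), `|d| `^ rho < e.
Proof.
move=> r0 e0; exists (e `^ rho^-1) => /=; first exact: powR_gt0.
move=> d; rewrite /= sub0r normrN => de.
have -> : e = (e `^ rho^-1) `^ rho by rewrite -powRrM mulVf ?gt_eqF// powRr1// ltW.
by rewrite gt0_ltr_powR ?nnegrE// powR_ge0.
Qed.

(** The function [f'] of [C1bound] is the derivative of [f] inside [A]. *)
Lemma C1bound_cvg (R : realType) (rho : R) (A : set R) f f' B x :
  0 < rho -> C1bound rho A f f' B -> A x ->
  (fun y => (f y - f x) / (y - x)) @ within A x^' --> f' x.
Proof.
move=> r0 fB Ax; have B0 := C1bound_ge0 Ax fB; case: fB => _ _ h.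
apply/cvgrPdist_lt => e e0.
have [d /= d0 hd] : \forall d \near (0 : R), `|d| `^ rho < e / (B + 1).
  by apply: powR_small; rewrite // divr_gt0// ltr_wpDl.
apply: within_dnbhsW; exists d => //= y yd Ay yx.
have yx0 : y - x != 0 by rewrite subr_eq0.
have -> : f' x - (f y - f x) / (y - x) = - ((f y - f x - f' x * (y - x)) / (y - x)).
  by field.
rewrite normrN normrM normfV ltr_pdivrMr ?normr_gt0//.
apply: le_lt_trans (h _ _ Ax Ay) _; rewrite mulrCA mulrC ltr_pM2r ?normr_gt0//.
have := hd (y - x); rewrite /= sub0r normrN -distrC => /(_ yd).
rewrite ltr_pdivlMr ?ltr_wpDl// => hh; rewrite distrC in hh.
apply: le_lt_trans hh; rewrite [leLHS]mulrC (distrC x y) ler_wpM2l ?powR_ge0//; lra.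
Qed.

Lemma C1bound_derive (R : realType) (rho : R) (A : set R) f f' B a b x :
  0 < rho -> C1bound rho A f f' B -> a < b -> a <= x <= b -> `[a, b] `<=` A ->
  derivable_on A f x /\ derive_on A f x = f' x.
Proof.
move=> r0 fB ab axb abA; have pf := within_dnbhs_proper ab axb abA.
have Ax : A x by apply: abA; rewrite /= in_itv.
have fx := C1bound_cvg r0 fB Ax.
by split; [apply/cvg_ex; exists (f' x)|apply: cvg_lim fx].
Qed.

Lemma C1bound_deriv_holder (R : realType) (rho : R) (A : set R) f f' B x y :
  C1bound rho A f f' B -> A x -> A y -> 
  `|f' x - f' y| <= 2 * B * `|x - y| `^ rho.
Proof.
move=> fB Ax Ay; have B0 := C1bound_ge0 Ax fB; case: fB => _ _ h.
have [->|xy] := eqVneq x y; first by rewrite subrr normr0 !mulr_ge0 ?powR_ge0.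
have xy0 : 0 < `|x - y| by rewrite normr_gt0 subr_eq0.
rewrite -(ler_pM2r xy0) -normrM.
rewrite (_ : (f' x - f' y) * (x - y) = (f y - f x - f' x * (y - x)) +
   (f x - f y - f' y * (x - y))); last by ring.
apply: le_trans (ler_normD _ _) _; apply: le_trans (lerD (h _ _ Ax Ay) (h _ _ Ay Ax)) _.
by rewrite (distrC y x) le_eqVlt; apply/orP; left; apply/eqP; ring.
Qed.

Lemma C1bound_C1holder_on (R : realType) (rho : R) f f' B a b :
  0 < rho -> a < b -> C1bound rho `[a, b] f f' B -> C1holder_on rho `[a, b] f.
Proof.
move=> r0 ab fB; split => [x xab|].
  by have [] := C1bound_derive r0 fB ab xab (@subset_refl _ _).
exists (2 * B) => x y xab yab.
have [_ ->] := C1bound_derive r0 fB ab xab (@subset_refl _ _).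
have [_ ->] := C1bound_derive r0 fB ab yab (@subset_refl _ _).
exact: C1bound_deriv_holder fB xab yab.
Qed.

Lemma C1holder_norm_le (R : realType) (rho : R) f f' B a b :
  0 < rho -> a < b -> C1bound rho `[a, b] f f' B ->
  (C1holder_norm rho `[a, b] f <= (4 * B)%:E)%E.
Proof.
move=> r0 ab fB; have fd x (xab : `[a, b]%classic x) := C1bound_derive r0 fB ab xab (@subset_refl _ _).
have -> : 4 * B = B + B + 2 * B by ring.
rewrite /C1holder_norm !EFinD; apply: leeD; first apply: leeD.
- by apply: ge_ereal_sup => _ [x xab <-]; rewrite lee_fin; case: fB => + _ _; apply.
- apply: ge_ereal_sup => _ [x xab <-]; rewrite lee_fin (fd _ xab).2.
  by case: fB => _ + _; apply.
- apply: ge_ereal_sup => _ [[x y] /= [xab yab xy] <-]; rewrite lee_fin.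
  rewrite (fd _ xab).2 (fd _ yab).2 ler_pdivrMr ?powR_gt0 ?normr_gt0 ?subr_eq0//.
  exact: C1bound_deriv_holder fB xab yab.
Qed.

Lemma derive_on_eq (R : realType) (A : set R) f g x : A x ->
  (forall y, A y -> f y = g y) -> derive_on A f x = derive_on A g x.
Proof.
move=> Ax fg; rewrite /derive_on; congr lim; apply/seteqP; split => P /=;
  rewrite /nbhs/=;
  apply: (@filterS _ x^') => y /= + Ay => /(_ Ay); by rewrite !fg.
Qed.

Lemma C1holder_norm_eq (R : realType) (rho : R) (A : set R) f g :
  (forall y, A y -> f y = g y) -> C1holder_norm rho A f = C1holder_norm rho A g.
Proof.
move=> fg; have fg' x (Ax : A x) := derive_on_eq Ax fg.
rewrite /C1holder_norm; congr (_ + _ + _)%E; congr ereal_sup; apply: eq_imagel => x.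
- by move=> Ax; rewrite fg.
- by move=> Ax; rewrite fg'.
- by case=> Ax Ay _; rewrite !fg'.
Qed.

Lemma derivable_on_continuous (R : realType) (A : set R) f x :
  derivable_on A f x -> f @ within A (nbhs x) --> f x.
Proof.
move=> /cvg_ex[l /cvgrPdist_lt h]; apply/cvgrPdist_lt => e e0.
have [d /= d0 hd] := h 1 ltr01.
exists (Num.min d (e / (`|l| + 1))) => /=; first by rewrite lt_min d0 divr_gt0// ltr_wpDl.
move=> y; rewrite /= lt_min => /andP[yd ye] Ay.
have [->|yx] := eqVneq y x; first by rewrite subrr normr0.
have /= := hd y yd yx Ay => hy.
have yx0 : 0 < `|y - x| by rewrite normr_gt0 subr_eq0.
have q1 : `|(f y - f x) / (y - x)| < `|l| + 1.
  rewrite -[X in `|X|](subKr l); apply: le_lt_trans (ler_normB _ _) _.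
  by rewrite ltrD2l.
rewrite distrC -[X in `|X|](@divfK _ (y - x)) ?subr_eq0//.
rewrite normrM; move: ye; rewrite ltr_pdivlMr ?ltr_wpDl// distrC mulrC.
by apply: le_lt_trans; rewrite ler_wpM2r// ltW.
Qed.

Lemma derivable_on_is_derive (R : realType) (A : set R) f x :
  nbhs x A -> derivable_on A f x -> is_derive x 1 f (derive_on A f x).
Proof.
move=> nA fx.
have q : (fun y => (f y - f x) / (y - x)) @ x^' --> derive_on A f x.
  apply: cvg_trans fx; apply: cvg_app => P; rewrite /within /=.
  have nA' : x^' A by exact: nbhs_dnbhs.
  by move=> h; apply: (@filterS2 _ x^' _ _ _ _ _ nA' h) => y Ay; exact.
have q0 : (fun h : R => h^-1 *: (f (h *: 1 + x) - f x)) @ 0^' --> derive_on A f x.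
  have -> : (fun h : R => h^-1 *: (f (h *: 1 + x) - f x)) =
      (fun y => (f y - f x) / (y - x)) \o (fun h => h + x).
    by apply/funext => h /=; rewrite addrK mulrC; congr (_ * (f (_ + _) - _)); exact: mulr1.
  apply: cvg_comp q => P [e /= e0 he]; exists e => // h /= hd hn0.
  rewrite sub0r normrN in hd.
  apply: he; rewrite /= ?opprD ?addrA; first by rewrite addrC addKr normrN.
  by rewrite -subr_eq0 addrK.
by split; [apply/cvg_ex; eexists; exact: q0|apply: cvg_lim q0].
Qed.

(** The hypotheses of the mean value theorem on [[a, b]], from derivability
    inside a larger set [A]. *)
Lemma MVT_on (R : realType) (A : set R) f (a b : R) :
  a < b -> `[a, b] `<=` A -> (forall x, a <= x <= b -> derivable_on A f x) ->
  {within `[a, b], continuous f} /\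
  forall x, a < x < b -> is_derive x 1 f (derive_on A f x).
Proof.
move=> ab abA fd; split.
  apply/subspace_continuousP => x xab.
  apply: cvg_trans (derivable_on_continuous (fd _ xab)).
  by apply: cvg_app => P; apply: (@filterS _ (nbhs x)) => y + yab; apply; exact: abA.
move=> x /andP[ax xb]; apply: derivable_on_is_derive; last by apply: fd; rewrite !ltW.
have xab : x \in `]a, b[ by rewrite in_itv/= ax.
by apply: filterS (near_in_itvoo xab) => y yab; apply: abA; exact: subset_itv_oo_cc yab.
Qed.

(** * Diffeomorphisms of class C^{1+rho} *)

(** The converse of [C1bound_C1holder_on], by the mean value theorem. *)
Lemma C1holder_on_C1bound (R : realType) (rho : R) f (a b : R) :
  0 < rho -> a < b <= a + 1 -> C1holder_on rho `[a, b] f ->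
  exists B, C1bound rho `[a, b] f (derive_on `[a, b] f) B.
Proof.
move=> r0 /andP[ab ba] [fd [K hK]].
have [fc fi] := MVT_on ab (@subset_refl _ _) fd.
have aab : a <= a <= b by rewrite lexx ltW.
have dist1 := @diam1_itv R a b ba.
have K0 x y : `[a, b]%classic x -> `[a, b]%classic y -> K * `|x - y| `^ rho <= `|K|.
  move=> xab yab; apply: le_trans (ler_norm _) _.
  rewrite normrM ler_piMr// ger0_norm ?powR_ge0//.
  by have /andP[] := powR_le1 r0 (a := `|x - y|) ltac:(by rewrite normr_ge0 dist1).
set g := derive_on `[a, b] f.
have gb x : a <= x <= b -> `|g x| <= `|g a| + `|K|.
  move=> xab; rewrite -[g x](subrK (g a)) addrC.
  apply: le_trans (ler_normD _ _) _; rewrite lerD2l.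
  exact: le_trans (hK _ _ xab aab) (K0 _ _ xab aab).
exists (`|f a| + `|g a| + `|K|); split => [x|x|x y]; rewrite /= !in_itv/=.
- move=> xab; have [z [zab _] e] := MVT_itv fc fi aab xab.
  rewrite -[f x](subrK (f a)) addrC -addrA e.
  apply: le_trans (ler_normD _ _) _; rewrite lerD2l normrM.
  apply: (@le_trans _ _ `|g z|); first by rewrite ler_piMr// dist1.
  exact: gb.
- by move=> /gb /le_trans; apply; rewrite lerD2r ler_wpDl.
- move=> xab yab; have [z [zab zx] e] := MVT_itv fc fi xab yab.
  rewrite e -mulrBl normrM.
  apply: (@le_trans _ _ (`|K| * (`|y - x| * `|y - x| `^ rho))).
    rewrite mulrCA [leLHS]mulrC ler_wpM2l//; apply: le_trans (hK _ _ zab xab) _.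
    apply: (@le_trans _ _ (`|K| * `|z - x| `^ rho)).
      by rewrite ler_wpM2r ?ler_norm// powR_ge0.
    by rewrite ler_wpM2l// ge0_ler_powR ?nnegrE// ltW.
  by rewrite ler_wpM2r ?mulr_ge0 ?powR_ge0// ler_wpDl ?addr_ge0.
Qed.

(** A [C^{1+rho}] bijection of intervals that multiplies distances by at least
    [kappa > 0] has a [C^{1+rho}] inverse. *)
Lemma C1bound_diffeo (R : realType) (rho kappa : R) f f' (B a b D : R) :
  0 < rho -> a < b <= a + 1 -> 0 < D -> 0 < kappa ->
  C1bound rho `[a, b] f f' B ->
  (forall x y : R, a <= x <= b -> a <= y <= b -> kappa * `|y - x| <= `|f y - f x|) ->
  set_bij `[a, b] `[0, D] f -> C1holder_diffeo rho `[a, b] `[0, D] f.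
Proof.
move=> r0 /andP[ab ba] D0 k0 fB lb bij; split => //.
  exact: C1bound_C1holder_on fB.
have aab : `[a, b]%classic a by rewrite /= in_itv/= lexx ltW.
have B0 := C1bound_ge0 aab fB.
have lb' x : `[a, b]%classic x -> kappa <= `|f' x|.
  move=> xab; have pf := within_dnbhs_proper ab xab (@subset_refl _ _).
  have /(_ _)qn := cvg_norm (C1bound_cvg r0 fB xab).
  rewrite -(cvg_lim (@Rhausdorff R) qn); apply: limr_ge.
    by apply/cvg_ex; eexists; exact: qn.
  apply: within_dnbhsW; apply: (@filterE _ (nbhs x)) => y yab yx.
  by rewrite /= normrM normfV ler_pdivlMr ?normr_gt0 ?subr_eq0// lb.
have [fun_f inj_f surj_f] := bij.
have ik0 : 0 < kappa^-1 by rewrite invr_gt0.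
pose g u := xget a [set x | `[a, b]%classic x /\ f x = u].
have fg u : `[0, D]%classic u -> `[a, b]%classic (g u) /\ f (g u) = u.
  move=> /surj_f[x xab fx].
  by apply: (@xgetPex R a [set x | `[a, b]%classic x /\ f x = u]); exists x; split.
have lbg u v : `[0, D]%classic u -> `[0, D]%classic v ->
    `|g v - g u| <= kappa^-1 * `|v - u|.
  move=> /fg[gu eu] /fg[gv ev]; rewrite mulrC ler_pdivlMr// mulrC.
  by rewrite -{2}eu -{2}ev lb.
exists g; split.
  move=> x xab; have [gab gx] := fg _ (fun_f _ xab).
  by apply: inj_f gx; rewrite inE.
pose K := B * kappa^-1 * kappa^-1 * kappa^-1 `^ rho.
have K0 : 0 <= K by rewrite !mulr_ge0 ?powR_ge0// ltW.
(* the derivative of the inverse is [1 / f'] at the preimage; the constant [K]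
   comes from rescaling the remainder of [f] *)
suff : C1bound rho `[0, D] g (fun u => (f' (g u))^-1) (`|a| + 1 + kappa^-1 + K).
  exact: C1bound_C1holder_on.
split => [u /fg[guab _]|u /fg[/lb' h _]|u v uD vD].
- have h := diam1_itv ba aab guab.
  rewrite -[g u](subrK a) addrC; apply: le_trans (ler_normD _ _) _.
  by rewrite -!addrA lerD2l; apply: le_trans h _; rewrite lerDl addr_ge0 ?(ltW ik0).
- rewrite /= normfV; apply: (@le_trans _ _ kappa^-1).
    by rewrite lef_pV2 ?posrE// (lt_le_trans k0).
  by rewrite -addrA addrCA lerDl !addr_ge0.
- have [guab eu] := fg _ uD; have [gvab ev] := fg _ vD.
  have f'0 : f' (g u) != 0 by rewrite -normr_gt0 (lt_le_trans k0)// lb'.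
  have := lbg _ _ uD vD.
  move: (g u) (g v) guab gvab f'0 eu ev {uD vD} => x y guab gvab f'0 <- <-.
  set e := `|f y - f x| => he.
  have e0 : 0 <= e by exact: normr_ge0.
  rewrite (_ : y - x - _ = - ((f y - f x - f' x * (y - x)) * (f' x)^-1)); last by field.
  rewrite normrN normrM normfV.
  apply: (@le_trans _ _ (K * (e * e `^ rho))); last first.
    by rewrite ler_wpM2r ?mulr_ge0 ?powR_ge0// lerDr !addr_ge0// (ltW ik0).
  apply: (@le_trans _ _ ((B * ((kappa^-1 * e) * (kappa^-1 * e) `^ rho)) * kappa^-1)).
    apply: ler_pM; rewrite ?invr_ge0//; last first.
      by rewrite lef_pV2 ?posrE ?normr_gt0// lb'.
    case: fB => _ _ h; apply: le_trans (h _ _ guab gvab) _.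
    rewrite ler_wpM2l// ler_pM ?powR_ge0//.
    by rewrite ge0_ler_powR ?nnegrE ?(ltW r0)// mulr_ge0// ltW.
  rewrite powRM ?(ltW ik0)// /K le_eqVlt; apply/orP; left; apply/eqP; ring.
Qed.

Lemma C1holder_diffeo_lower (R : realType) (rho : R) phi (a b U : R) :
  0 < rho -> 0 < U <= 1 -> C1holder_diffeo rho `[a, b] `[0, U] phi ->
  exists2 kappa : R, 0 < kappa & forall x y : R, a <= x <= b -> a <= y <= b ->
    kappa * `|y - x| <= `|phi y - phi x|.
Proof.
move=> r0 /andP[U0 U1] [[fun_phi _ _] _ [psi [psiK hpsi]]].
have [|B hB] := C1holder_on_C1bound r0 _ hpsi; first by rewrite add0r U0.
have B0 : 0 <= B by apply: (C1bound_ge0 (x := 0) _ hB); rewrite /= in_itv/= lexx ltW.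
exists (2 * B + 1)^-1; first by rewrite invr_gt0; lra.
move=> x y xab yab; rewrite mulrC ler_pdivrMr; last by lra.
have d1 : diam1 `[0, U] by apply: diam1_itv; rewrite add0r.
have := C1bound_lip r0 d1 hB (fun_phi _ xab) (fun_phi _ yab).
rewrite !psiK// => /le_trans; apply; rewrite mulrC ler_wpM2l//; lra.
Qed.

(** * Perturbation of a chart *)

(** The perturbation of a chart [phi] of height [d].  The function
    [m] and its composition with [phi] do not depend on [s], and the new chart
    [psi] corresponds to adding [s * m (phi x)] to [phi x `^ beta] and lowering
    the whole branch by [s]. *)
Lemma perturb_chart (R : realType) (rho beta a b d : R) (phi : R -> R)
    (L : seq R) :
  0 < rho <= 1 -> 0 < beta < 1 -> a < b <= a + 1 -> 0 < d <= 1 ->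
  C1holder_diffeo rho `[a, b] `[0, d `^ beta^-1] phi ->
  (forall w, w \in L -> 0 < w) ->
  exists m : R -> R,
  [/\ [/\ forall u : R, 0 <= m u, m 0 = 1, forall w, w \in L -> m w = 0 &
          m (d `^ beta^-1) = 0],
      C1bounded rho `[a, b] (fun x => m (phi x)) &
      forall eps : R, 0 < eps -> exists2 s0 : R, 0 < s0 & forall s : R, 0 <= s <= s0 ->
        s < d /\ exists psi,
        [/\ C1holder_diffeo rho `[a, b] `[0, (d - s) `^ beta^-1] psi,
          forall x : R, a <= x <= b ->
            psi x `^ beta = phi x `^ beta - s * (1 - m (phi x)),
          forall x, phi x = 0 -> psi x = 0,
          forall x, phi x = d `^ beta^-1 -> psi x = (d - s) `^ beta^-1 &
          (C1holder_norm rho `[a, b] (fun x => (phi x - psi x)%R) <= eps%:E)%E]].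
Proof.
move=> r01 /andP[b0 b1] /andP[ab ba] /andP[d0 d1] hphi L0.
have r0 : 0 < rho by case/andP: r01.
set gam := beta^-1; set U := d `^ gam.
have g1 : 1 < gam by rewrite invf_gt1.
have gam0 : 0 < gam by exact: lt_trans g1.
have gamb : gam * beta = 1 by rewrite mulVf// gt_eqF.
have U0 : 0 < U by exact: powR_gt0.
have U1 : U <= 1.
  by have /andP[] := powR_le1 gam0 (a := d) ltac:(by rewrite d1 (ltW d0)).
have UbE : U `^ beta = d by rewrite -powRrM gamb powRr1// ltW.
have [|q [r [hq hr rq r1 rL]]] := exists_bump (L := U :: L) r01 b0.
  by move=> w; rewrite in_cons => /orP[/eqP->//|]; exact: L0.
have dab := diam1_itv ba.
have d01 : diam1 `[(0:R), 1] by apply: diam1_itv; rewrite add0r.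
have [|kappa k0 klb] := C1holder_diffeo_lower r0 _ hphi; first by rewrite U0.
have [fun_phi inj_phi surj_phi] : set_bij `[a, b] `[0, U] phi by case: hphi.
have [Bp hp] : exists B, C1bound rho `[a, b] phi (derive_on `[a, b] phi) B.
  by apply: C1holder_on_C1bound; rewrite ?ab//; case: hphi.
have phi01 x : `[a, b]%classic x -> `[0, 1]%classic (phi x).
  move/fun_phi; rewrite /= !in_itv/= => /andP[-> /le_trans]; exact.
have aab : `[a, b]%classic a by rewrite /= in_itv/= lexx ltW.
have Bp0 := C1bound_ge0 aab hp.
have dq : d * q U = 1 by have := rL U (mem_head _ _); rewrite rq ?(ltW U0)// UbE.
exists (fun u => 1 - r u); split.
- split => [u||w wL|]; first by rewrite subr_ge0.
  + by rewrite rq// powR0 ?mul0r ?subr0// gt_eqF.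
  + by rewrite rL ?subrr// in_cons wL orbT.
  + by rewrite rL ?subrr// mem_head.
- apply: (@C1bounded_comp _ rho _ `[0, 1] phi (fun u => 1 - r u)) => //.
    by do 2 eexists; exact: hp.
  have := C1boundedD (C1bounded_cst rho `[0, 1] 1) (C1boundedZ (-1) hr).
  case=> f' [B hB]; exists f', B; apply: C1bound_ext hB => // x _.
  by rewrite mulN1r.
move=> eps eps0.
have [C [s1 [C0 s10 hk]]] := C1bound_powR_perturb r01 g1 hq.
set M := 1 + Bp + 2 * Bp * (2 * Bp) `^ rho.
have M1 : 1 <= M.
  by rewrite /M -addrA lerDl addr_ge0// !mulr_ge0 ?powR_ge0.
(* the perturbation of the chart must be small against [kappa], the
   least factor by which [phi] multiplies distances, for injectivity, and against [eps], for the norm *)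
pose delta := Num.min 2^-1 (Num.min (kappa / 4) (eps / 4)).
have delta0 : 0 < delta by rewrite !lt_min invr_gt0 ltr0n !divr_gt0.
have CM0 : 0 <= C * M by rewrite mulr_ge0// (le_trans ler01).
have CM1 : 0 < C * M + 1 by lra.
pose s0 := Num.min (Num.min s1 (d / 2)) (delta / (C * M + 1)).
exists s0; first by rewrite !lt_min s10 !divr_gt0.
move=> s /andP[sge0]; rewrite !le_min => /andP[/andP[ss1 sd] sdelta].
have sCM : s * C * M <= delta.
  move: sdelta; rewrite ler_pdivlMr// => h.
  by apply: le_trans h; rewrite -mulrA ler_wpM2l//; lra.
have sC : s * C <= delta.
  by apply: le_trans sCM; rewrite ler_peMr// mulr_ge0.
have [dl1 dl2 dl3] : [/\ delta <= 2^-1, delta <= kappa / 4 & delta <= eps / 4].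
  by split; rewrite /delta !ge_min lexx ?orbT.
have sltd : s < d by lra.
split => //.
have [hs [k' hk']] := hk s ltac:(by rewrite sge0).
pose k (u : R) : R := u * ((1 - s * q u) `^ gam - 1).
have {}hk' : C1bound rho `[0, 1] k k' (s * C) by [].
pose Psi u := u * (1 - s * q u) `^ gam.
have PsiE u : Psi u = u + k u by rewrite /Psi /k; ring.
have PsiU : Psi U = (d - s) `^ gam.
  rewrite /Psi /U -powRM ?(ltW d0)//; last first.
    by apply: (le_trans _ (hs _ _)); rewrite ?invr_ge0// U1 ltW.
  by congr (_ `^ _); rewrite mulrBr mulr1 mulrCA dq mulr1.
have Psi0 : Psi 0 = 0 by rewrite /Psi mul0r.
have Psi_ge0 u : 0 <= u -> 0 <= Psi u by move=> u0; rewrite mulr_ge0 ?powR_ge0.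
have Psi_le u v : 0 <= u -> u <= v -> v <= 1 -> Psi u <= Psi v.
  move=> u0 uv v1; rewrite -subr_ge0 !PsiE.
  have u01 : `[0, 1]%classic u by rewrite /= in_itv/= u0 (le_trans uv).
  have v01 : `[0, 1]%classic v by rewrite /= in_itv/= v1 (le_trans u0).
  have := C1bound_lip r0 d01 hk' u01 v01.
  rewrite (@ger0_norm _ (v - u)) ?subr_ge0// ler_norml => /andP[h _].
  have : 2 * (s * C) * (v - u) <= 1 * (v - u) by rewrite ler_wpM2r ?subr_ge0//; lra.
  lra.
have hkp := C1bound_comp r0 dab phi01 hp hk'.
rewrite -/M in hkp.
have hpsi := C1boundD hp hkp.
pose psi x := Psi (phi x).
have {}hpsi : C1bound rho `[a, b] psi (fun x => derive_on `[a, b] phi x +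
    k' (phi x) * derive_on `[a, b] phi x) (Bp + s * C * M).
  by apply: C1bound_ext hpsi => // x _; rewrite /psi PsiE.
have lb x y : a <= x <= b -> a <= y <= b -> kappa / 2 * `|y - x| <= `|psi y - psi x|.
  move=> xab yab; rewrite /psi !PsiE.
  have h1 := klb _ _ xab yab.
  have h2 := C1bound_lip r0 dab hkp xab yab.
  rewrite (_ : _ - (phi x + _) = (phi y - phi x) - (k (phi x) - k (phi y))); last by ring.
  apply: le_trans (lerB_normD _ _); rewrite ?normrN.
  have h3 : 2 * (s * C * M) * `|y - x| <= kappa / 2 * `|y - x|.
    by rewrite ler_wpM2r//; lra.
  rewrite distrC in h2; lra.
exists psi; split.
- apply: (C1bound_diffeo r0 _ _ _ hpsi lb); rewrite ?ab//.
  + by apply: powR_gt0; rewrite subr_gt0.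
  + by rewrite divr_gt0.
  split.
  + move=> x /fun_phi; rewrite /= !in_itv/= => /andP[p0 pU].
    by rewrite -PsiU Psi_ge0//= Psi_le.
  + move=> x y; rewrite !inE => xab yab e; apply/eqP; rewrite eq_sym -subr_eq0 -normr_eq0.
    have := lb _ _ xab yab; rewrite e subrr normr0 pmulr_rle0 ?divr_gt0//.
    by rewrite normr_le0 normr_eq0.
  + move=> v; rewrite /= in_itv/= => /andP[v0 vU].
    have [||u] := @IVT R Psi 0 U v (ltW U0).
    * have [PB hPB] : C1bounded rho `[0, 1] Psi.
        have := C1boundD (C1bound_id rho) hk'.
        move=> h; do 2 eexists; apply: (C1bound_ext (g := Psi) _ _ h) => x _.
          by rewrite PsiE.
        by reflexivity.
      case: hPB => BB hPB; have [h _] := C1bound_C1holder_on r0 ltr01 hPB.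
      have [hc _] := MVT_on ltr01 (@subset_refl _ _) h.
      apply: continuous_subspaceW hc => x; rewrite /= !in_itv/= => /andP[-> /le_trans].
      exact.
    * rewrite Psi0 PsiU; have -> : Num.min 0 ((d - s) `^ gam) = 0.
        by apply/min_idPl; exact: powR_ge0.
      by rewrite v0/= le_max vU orbT.
    * rewrite in_itv/= => uU <-; have [x xab <-] := surj_phi u uU.
      by exists x.
- move=> x xab; have := fun_phi _ xab; rewrite /= in_itv/= => /andP[p0 pU].
  have ge0 : 0 <= 1 - s * q (phi x).
    by apply: (le_trans _ (hs _ _)); rewrite ?invr_ge0// p0 (le_trans pU).
  rewrite /psi /Psi powRM ?powR_ge0// -powRrM gamb powRr1//.
  by rewrite rq//; ring.
- by move=> x p0; rewrite /psi p0.
- by move=> x pU; rewrite /psi pU.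
- apply: (@le_trans _ _ (4 * (`|-1| * (s * C * M)))%:E); last first.
    by rewrite lee_fin normrN1 mul1r; lra.
  have := C1holder_norm_le r0 ab (C1boundZ (-1) hkp).
  rewrite (@C1holder_norm_eq _ _ _ _ (fun x => phi x - psi x))// => x _.
  by rewrite /psi PsiE; ring.
Qed.

(** * A parameter for which the singular orbit returns *)

Lemma exists_expr_gt (R : realType) (sigma x : R) :
  1 < sigma -> exists n, x < sigma ^+ n.
Proof.
move=> s1; have d0 : 0 < sigma - 1 by rewrite subr_gt0.
have bern n : n%:R * (sigma - 1) <= sigma ^+ n.
  suff : 1 + n%:R * (sigma - 1) <= sigma ^+ n by lra.
  elim: n => [|n IH]; first by rewrite mul0r addr0.
  have n0 : 0 <= n%:R * (sigma - 1) :> R by rewrite mulr_ge0// ltW.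
  have : (1 + n%:R * (sigma - 1)) * sigma <= sigma ^+ n * sigma.
    by rewrite ler_wpM2r//; lra.
  rewrite exprSr -natr1 => /(le_trans _); apply.
  have := mulr_ge0 n0 (ltW d0); lra.
have := archi_boundP (normr_ge0 (x / (sigma - 1))); set n := Num.bound _ => h.
exists n; apply: lt_le_trans (bern n); rewrite -ltr_pdivrMr//.
by apply: le_lt_trans h; exact: ler_norm.
Qed.

(** For the family [h_s = F + s * M], nondecreasing in [s] and whose top map
    [h_s0] is expanding on both sides of [c], the orbit of [v + s] reaches [c]
    for some [s]. *)
Lemma exists_param_hits_right (R : realType) (c sigma v s0 : R) (F M : R -> R) :
  0 < s0 -> 1 < sigma ->
  (forall x : R, 0 < x < 1 -> x != c -> {for x, continuous F}) ->
  (forall x : R, 0 < x < 1 -> x != c -> {for x, continuous M}) ->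
  (forall x : R, 0 < x < 1 -> x != c -> 0 <= M x) ->
  (forall s : R, 0 < s <= s0 -> 0 < v + s < 1) ->
  (forall s x : R, 0 < s <= s0 -> 0 < x < 1 -> x != c -> 0 < F x + s * M x < 1) ->
  (forall x y : R, 0 < x -> x < y -> y < 1 -> (y < c) || (c < x) ->
     sigma * (y - x) <= (F y + s0 * M y) - (F x + s0 * M x)) ->
  exists s n, 0 < s <= s0 /\ iter n (fun x => F x + s * M x) (v + s) = c.
Proof.
move=> s00 s1 Fc Mc M0 v01 h01 hexp; apply: contrapT => nex.
pose Y n s := iter n (fun x => F x + s * M x) (v + s).
have Yc n s : 0 < s <= s0 -> Y n s != c.
  by move=> ss; apply/eqP => e; apply: nex; exists s, n.
have Y01 n s : 0 < s <= s0 -> 0 < Y n s < 1.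
  move=> ss; elim: n => [|n IH]; first exact: v01.
  exact: h01 ss IH (Yc n s ss).
(* compare the orbits for the parameters [s'] and [s0] *)
set s' := s0 / 2.
have s'0 : 0 < s' by rewrite divr_gt0.
have s's : s' < s0 by rewrite /s'; lra.
have ss' s : s' <= s <= s0 -> 0 < s <= s0.
  by move=> /andP[h ->]; rewrite (lt_le_trans s'0).
have Ycont n : {within `[s', s0], continuous (Y n)}.
  elim: n => [|n /subspace_continuousP IH]; apply/subspace_continuousP => s sin.
    apply: cvgD; first exact: cvg_cst.
    exact: cvg_within.
  have sin0 := ss' _ sin.
  have Yn := Y01 n _ sin0; have Ync := Yc n _ sin0.
  have h1 : F (Y n t) @[t --> within `[s', s0] (nbhs s)] --> F (Y n s).
    exact: (cvg_comp _ _ (IH _ sin) (Fc _ Yn Ync)).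
  have h2 : M (Y n t) @[t --> within `[s', s0] (nbhs s)] --> M (Y n s).
    exact: (cvg_comp _ _ (IH _ sin) (Mc _ Yn Ync)).
  apply: cvgD h1 _; apply: cvgM h2; exact: cvg_within.
have s's0 : 0 < s' <= s0 by rewrite s'0 ltW.
have s0s0 : 0 < s0 <= s0 by rewrite s00 lexx.
have side n : Y n s' <= Y n s0 -> (Y n s0 < c) || (c < Y n s').
  move=> le; apply: contraT; rewrite negb_or -!leNgt => /andP[c2 c1].
  have [|s sin /eqP] := @IVT R (Y n) s' s0 c (ltW s's) (Ycont n).
    by rewrite ge_min le_max c1 c2 orbT.
  by rewrite (negbTE (Yc _ _ (ss' _ sin))).
have grow n : sigma ^+ n * s' <= Y n s0 - Y n s'.
  elim: n => [|n IH].
    by rewrite expr0 mul1r /Y/= /s'; lra.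
  have sn : 0 < sigma ^+ n * s' by rewrite mulr_gt0// exprn_gt0//; lra.
  have lt : Y n s' < Y n s0 by lra.
  have /andP[a0 a1] := Y01 n _ s's0; have /andP[b0 b1] := Y01 n _ s0s0.
  have := hexp _ _ a0 lt b1 (side n (ltW lt)).
  have Mge : s' * M (Y n s') <= s0 * M (Y n s').
    by rewrite ler_wpM2r ?(ltW s's)// M0 ?a0 ?Yc.
  have e : sigma * (sigma ^+ n * s') <= sigma * (Y n s0 - Y n s').
    by rewrite ler_wpM2l//; lra.
  rewrite exprS -mulrA /Y !iterS -!/(Y _ _); lra.
(* the two orbits stay in [(0, 1)] but their distance exceeds 1 *)
have [n hn] := exists_expr_gt (s'^-1) s1.
have := grow n; have := Y01 n _ s's0; have := Y01 n _ s0s0.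
have : 1 < sigma ^+ n * s' by rewrite -ltr_pdivrMr// div1r.
by move=> h /andP[_ h1] /andP[h2 _]; lra.
Qed.

(** The mirror image, by the reflection [x |-> 1 - x]. *)
Lemma exists_param_hits_left (R : realType) (c sigma v s0 : R) (F M : R -> R) :
  0 < s0 -> 1 < sigma ->
  (forall x : R, 0 < x < 1 -> x != c -> {for x, continuous F}) ->
  (forall x : R, 0 < x < 1 -> x != c -> {for x, continuous M}) ->
  (forall x : R, 0 < x < 1 -> x != c -> 0 <= M x) ->
  (forall s : R, 0 < s <= s0 -> 0 < v - s < 1) ->
  (forall s x : R, 0 < s <= s0 -> 0 < x < 1 -> x != c -> 0 < F x - s * M x < 1) ->
  (forall x y : R, 0 < x -> x < y -> y < 1 -> (y < c) || (c < x) ->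
     sigma * (y - x) <= (F y - s0 * M y) - (F x - s0 * M x)) ->
  exists s n, 0 < s <= s0 /\ iter n (fun x => F x - s * M x) (v - s) = c.
Proof.
move=> s00 s1 Fc Mc M0 v01 h01 hexp.
have r01 (x : R) : 0 < x < 1 -> 0 < 1 - x < 1 by move=> /andP[? ?]; apply/andP; split; lra.
have rc (x : R) : x != 1 - c -> 1 - x != c.
  by apply: contra => /eqP <-; apply/eqP; ring.
have rcont (G : R -> R) x : {for 1 - x, continuous G} ->
    {for x, continuous (fun y : R => G (1 - y))}.
  move=> Gc; apply: (@continuous_comp _ _ _ (fun y : R => 1 - y) G) => //.
  by apply: cvgB; [exact: cvg_cst|exact: cvg_id].
have [||||||s [n [ss e]]] := @exists_param_hits_right R (1 - c) sigma (1 - v) s0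
  (fun x => 1 - F (1 - x)) (fun x => M (1 - x)) s00 s1.
- move=> x x01 xc; apply: cvgB; first exact: cvg_cst.
  by apply: rcont; apply: Fc; [exact: r01|exact: rc].
- by move=> x x01 xc; apply: rcont; apply: Mc; [exact: r01|exact: rc].
- by move=> x x01 xc; apply: M0; [exact: r01|exact: rc].
- by move=> s /v01 /andP[? ?]; apply/andP; split; lra.
- by move=> s x ss /r01 h /rc xc; have /andP[? ?] := h01 s _ ss h xc; apply/andP; split; lra.
- move=> x y x0 xy y1 side.
  have := hexp (1 - y) (1 - x); rewrite (_ : 1 - x - (1 - y) = y - x); last by ring.
  have -> : (1 - x < c) || (c < 1 - y).
    by case/orP: side => h; apply/orP; [right|left]; lra.
  move=> h; have := h ltac:(lra) ltac:(lra) ltac:(lra) isT; lra.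
exists s, n; split => //.
suff H k : iter k (fun x => 1 - F (1 - x) + s * M (1 - x)) (1 - v + s) =
    1 - iter k (fun x => F x - s * M x) (v - s).
  by move: e; rewrite H; lra.
elim: k => [|k IH]; first by rewrite /=; ring.
by rewrite !iterS IH !subKr; ring.
Qed.

(** * Charts and one-sided limits of Lorenz maps *)

(** [lorenz_charts] with the heights [d0 = f(c_-)] and [d1 = 1 - f(c_+)] named. *)
Definition lorenz_charts_with (R : realType) (rho c alpha beta : R) (f : R -> R)
    (phi : (R -> R) * (R -> R)) (d0 d1 : R) : Prop :=
  [/\ 0 <= d0 <= 1 /\ 0 <= d1 <= 1,
      C1holder_diffeo rho `[0, c] `[0, d0 `^ alpha^-1] phi.1 /\
      C1holder_diffeo rho `[c, 1] `[0, d1 `^ beta^-1] phi.2,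
      phi.1 c = 0 /\ phi.2 c = 0,
      phi.1 0 = d0 `^ alpha^-1 /\ phi.2 1 = d1 `^ beta^-1 &
      (forall x : R, 0 <= x < c -> f x = d0 - phi.1 x `^ alpha) /\
      (forall x : R, c < x <= 1 -> f x = 1 - d1 + phi.2 x `^ beta)].

Lemma powRVK (R : realType) (beta d : R) : 0 < beta -> 0 <= d ->
  (d `^ beta^-1) `^ beta = d.
Proof. by move=> b0 d0; rewrite -powRrM mulVf ?gt_eqF// powRr1. Qed.

Lemma chart_ge0 (R : realType) (rho : R) (A : set R) U phi x :
  C1holder_diffeo rho A `[0, U] phi -> A x -> 0 <= phi x <= U.
Proof. by move=> [[h _ _] _ _] /h; rewrite /= in_itv. Qed.

Lemma chart_inj (R : realType) (rho U : R) (A : set R) phi x y :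
  C1holder_diffeo rho A `[0, U] phi -> A x -> A y -> x != y -> phi x != phi y.
Proof.
move=> [[_ inj _] _ _] Ax Ay; apply: contra => /eqP e; apply/eqP.
by apply: inj; rewrite ?inE.
Qed.

Lemma chart_range_lt (R : realType) (rho beta d : R) (A : set R) phi x e0 e1 :
  0 < beta -> 0 <= d -> C1holder_diffeo rho A `[0, d `^ beta^-1] phi -> A x ->
  A e0 -> A e1 -> phi e0 = 0 -> phi e1 = d `^ beta^-1 -> x != e0 -> x != e1 ->
  0 < phi x `^ beta < d.
Proof.
move=> b0 d0 h Ax A0 A1 p0 p1 x0 x1.
have /andP[ge0 leU] := chart_ge0 h Ax.
have gt0 : 0 < phi x by rewrite lt0r ge0 -p0 (chart_inj h).
have ltU : phi x < d `^ beta^-1 by rewrite lt_neqAle leU -p1 (chart_inj h).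
rewrite powR_gt0//= -[ltRHS](powRVK b0 d0).
by rewrite gt0_ltr_powR ?nnegrE ?powR_ge0.
Qed.

Lemma chart_height_gt0 (R : realType) (rho beta d : R) (A : set R) phi e0 e1 :
  0 <= d -> C1holder_diffeo rho A `[0, d `^ beta^-1] phi ->
  A e0 -> A e1 -> e0 != e1 -> phi e0 = 0 -> phi e1 = d `^ beta^-1 -> 0 < beta ->
  0 < d.
Proof.
move=> d0 h A0 A1 e01 p0 p1 b0; have := chart_inj h A0 A1 e01.
rewrite p0 p1 lt0r d0 andbT; apply: contra => /eqP ->.
by rewrite powR0// invr_eq0 gt_eqF.
Qed.

(** Near the singularity [e0] the branch is close to its one-sided value. *)
Lemma chart_powR_cvg0 (R : realType) (rho beta U : R) (A : set R) phi e0 :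
  0 < beta -> C1holder_diffeo rho A `[0, U] phi -> A e0 -> phi e0 = 0 ->
  phi x `^ beta @[x --> within A (nbhs e0)] --> 0.
Proof.
move=> b0 h A0 p0; have [_ [hd _] _] := h.
have := derivable_on_continuous (hd _ A0); rewrite p0 => /cvgrPdist_lt pc.
apply/cvgrPdist_lt => e e_gt0.
have := pc _ (powR_gt0 beta^-1 e_gt0) => {}pc.
apply: (@filterS _ (nbhs e0) _ _ _ _ pc) => x + Ax => /(_ Ax).
have /andP[q0 _] := chart_ge0 h Ax.
rewrite !sub0r !normrN !ger0_norm ?powR_ge0// => q.
by rewrite -[ltRHS](powRVK b0 (ltW e_gt0)) gt0_ltr_powR ?nnegrE ?powR_ge0.
Qed.

Lemma cvg_to_at_left (R : realType) (F : set_system R) (f : R -> R) (l : R) :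
  Filter F -> f @ F --> l -> (\forall x \near F, f x < l) -> f @ F --> l^'-.
Proof.
by move=> FF fl lt P hP; have := fl _ hP; apply: filterS2 lt => x + h; exact: h.
Qed.

Lemma cvg_to_at_right (R : realType) (F : set_system R) (f : R -> R) (l : R) :
  Filter F -> f @ F --> l -> (\forall x \near F, l < f x) -> f @ F --> l^'+.
Proof.
by move=> FF fl lt P hP; have := fl _ hP; apply: filterS2 lt => x + h; exact: h.
Qed.

(** If [F] gives the left limits of [f], and these are approached from below,
    then the [n]-th iterates of [f] from the left of [c] converge to the [n]-th
    iterate of [F] at [c]. *)
Lemma iter_at_left (R : realType) (f F : R -> R) (c : R) n :
  (forall y, 0 < y <= 1 -> 0 < F y <= 1) ->
  (forall y, 0 < y <= 1 -> f @ y^'- --> (F y)^'-) -> 0 < c <= 1 ->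
  iter_left c f n = iter n F c.
Proof.
move=> F01 fF c01; have it01 k : 0 < iter k F c <= 1.
  by elim: k => //= k; exact: F01.
have h k : iter k f x @[x --> c^'-] --> (iter k F c)^'-.
  elim: k => [|k IH]; first exact: cvg_id.
  exact: (cvg_comp _ _ IH (fF _ (it01 k))).
apply: cvg_lim => //; apply: cvg_trans (h n) _; exact: cvg_within.
Qed.

Lemma iter_at_right (R : realType) (f F : R -> R) (c : R) n :
  (forall y, 0 <= y < 1 -> 0 <= F y < 1) ->
  (forall y, 0 <= y < 1 -> f @ y^'+ --> (F y)^'+) -> 0 <= c < 1 ->
  iter_right c f n = iter n F c.
Proof.
move=> F01 fF c01; have it01 k : 0 <= iter k F c < 1.
  by elim: k => //= k; exact: F01.
have h k : iter k f x @[x --> c^'+] --> (iter k F c)^'+.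
  elim: k => [|k IH]; first exact: cvg_id.
  exact: (cvg_comp _ _ IH (fF _ (it01 k))).
apply: cvg_lim => //; apply: cvg_trans (h n) _; exact: cvg_within.
Qed.

Lemma lorenz_dom_itv (R : realType) (c x y : R) :
  0 <= x -> y <= 1 -> (y < c) || (c < x) -> `[x, y] `<=` lorenz_dom c.
Proof.
move=> x0 y1 side z; rewrite /= in_itv/= => /andP[xz zy]; split.
  by rewrite /= in_itv/= (le_trans x0 xz) (le_trans zy y1).
by move=> zc; move: side; rewrite -zc !ltNge xz zy.
Qed.

Lemma lorenz_expand (R : realType) (c sigma : R) (f : R -> R) x y :
  (forall z, lorenz_dom c z -> derivable_on (lorenz_dom c) f z) ->
  (forall z, lorenz_dom c z -> sigma <= derive_on (lorenz_dom c) f z) ->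
  0 <= x -> x < y -> y <= 1 -> (y < c) || (c < x) ->
  sigma * (y - x) <= f y - f x.
Proof.
move=> fd fs x0 xy y1 side; have sub := lorenz_dom_itv x0 y1 side.
have [|fc fi] := MVT_on xy sub (f := f).
  by move=> z zxy; apply: fd; apply: sub; rewrite /= in_itv.
have [z zxy ->] := MVT xy (fun z hz => fi z ltac:(by move: hz; rewrite in_itv)) fc.
rewrite ler_wpM2r ?subr_ge0 ?(ltW xy)//; apply/fs/sub.
by rewrite /=; apply: subset_itv_oo_cc.
Qed.

Lemma nbhs_lorenz_dom (R : realType) (c x : R) : 0 < x < 1 -> x != c ->
  nbhs x (lorenz_dom c).
Proof.
move=> /andP[x0 x1] xc.
have h1 : \forall y \near x, 0 < y by exact: lt_nbhsr.
have h2 : \forall y \near x, y < 1 by exact: lt_nbhsl.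
have h3 : \forall y \near x, y != c.
  move: xc; rewrite neq_lt => /orP[xc|cx].
  - by apply: filterS (lt_nbhsl xc) => y yc; rewrite lt_eqF.
  - by apply: filterS (lt_nbhsr cx) => y yc; rewrite gt_eqF.
near=> y; split; last by move=> /= yc; have /eqP : y != c by near: y.
by rewrite /= in_itv/= !ltW//; near: y.
Unshelve. all: end_near. Qed.

(** Just to the left of [y], points are on the same side of [c] as [y], where
    [c] itself counts as lying on its left. *)
Lemma near_at_left_side (R : realType) (c y : R) : 0 < y ->
  \forall x \near y^'-, [/\ 0 < x, x < y & (y <= c) || (c < x)].
Proof.
move=> y0; have h : \forall x \near y, (y <= c) || (c < x).
  have [yc|cy] := leP y c; first by apply: (@filterE _ (nbhs y)) => x; rewrite ?yc.
  by apply: filterS (lt_nbhsr cy) => x ->.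
by apply: filterS2 (lt_nbhsr y0) h => x x0 hx xy.
Qed.

Lemma near_at_right_side (R : realType) (c y : R) : y < 1 ->
  \forall x \near y^'+, [/\ y < x, x < 1 & (x < c) || (c <= y)].
Proof.
move=> y1; have h : \forall x \near y, (x < c) || (c <= y).
  have [cy|yc] := leP c y; first by apply: (@filterE _ (nbhs y)) => x; rewrite ?cy orbT.
  by apply: filterS (lt_nbhsl yc) => x ->.
by apply: filterS2 (lt_nbhsl y1) h => x x0 hx xy.
Qed.

Lemma cvg_within_at_left (R : realType) (A : set R) (f : R -> R) (y l : R) :
  f @ within A (nbhs y) --> l -> (\forall x \near y^'-, A x) ->
  f @ y^'- --> l.
Proof.
move=> fl Ay P /fl; rewrite /= /nbhs/= => h.
by apply: (@filterS2 _ (nbhs y) _ _ _ _ _ Ay h) => x Ax + xy; apply; exact: Ax.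
Qed.

Lemma cvg_within_at_right (R : realType) (A : set R) (f : R -> R) (y l : R) :
  f @ within A (nbhs y) --> l -> (\forall x \near y^'+, A x) ->
  f @ y^'+ --> l.
Proof.
move=> fl Ay P /fl; rewrite /= /nbhs/= => h.
by apply: (@filterS2 _ (nbhs y) _ _ _ _ _ Ay h) => x Ax + xy; apply; exact: Ax.
Qed.

(** [f] with the value [v] at the singularity.  With [v = f(c_-)] it is
    left-continuous and its orbit of [c] is that of [c_-]; with [v = f(c_+)] it
    is right-continuous and its orbit of [c] is that of [c_+]. *)
Definition extend (R : realType) (c v : R) (f : R -> R) (x : R) : R :=
  if x == c then v else f x.

Lemma lorenz_charts_lim (R : realType) (rho c alpha beta : R) f phi d0 d1 :
  0 < c < 1 -> 0 < alpha -> 0 < beta ->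
  lorenz_charts_with rho c alpha beta f phi d0 d1 ->
  f @ c^'- --> d0^'- /\ f @ c^'+ --> (1 - d1)^'+.
Proof.
move=> /andP[c0 c1] a0 b0 [_ [h1 h2] [p1 p2] _ [f1 f2]].
have c0c : `[0, c]%classic c by rewrite /= in_itv/= lexx ltW.
have cc1 : `[c, 1]%classic c by rewrite /= in_itv/= lexx ltW.
have nl : \forall x \near c^'-, 0 <= x < c.
  by apply: filterS (near_at_left_side c c0) => x [x0 -> _]; rewrite ltW.
have nr : \forall x \near c^'+, c < x <= 1.
  by apply: filterS (near_at_right_side c c1) => x [-> x1 _]; rewrite ltW.
split.
- apply: cvg_to_at_left.
    apply: (@cvg_trans _ (d0 - phi.1 x `^ alpha @[x --> c^'-])).
      by apply: near_eq_cvg; apply: filterS nl => x /f1 ->.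
    suff : d0 - phi.1 x `^ alpha @[x --> c^'-] --> d0 - 0 by rewrite subr0.
    apply: cvgB; first exact: cvg_cst.
    apply: (cvg_within_at_left (chart_powR_cvg0 a0 h1 c0c p1)).
    by apply: filterS nl => x /andP[x0 xc]; rewrite /= in_itv/= x0 ltW.
  apply: filterS nl => x xc; rewrite f1// ltrBlDr ltrDl.
  case/andP: xc => x0 xc.
  have xA : `[0, c]%classic x by rewrite /= in_itv/= x0 ltW.
  have /andP[q0 _] := chart_ge0 h1 xA.
  by rewrite powR_gt0// lt0r q0 -p1 (chart_inj h1)// lt_eqF.
- apply: cvg_to_at_right.
    apply: (@cvg_trans _ (1 - d1 + phi.2 x `^ beta @[x --> c^'+])).
      by apply: near_eq_cvg; apply: filterS nr => x /f2 ->.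
    suff : 1 - d1 + phi.2 x `^ beta @[x --> c^'+] --> 1 - d1 + 0 by rewrite addr0.
    apply: cvgD; first exact: cvg_cst.
    apply: (cvg_within_at_right (chart_powR_cvg0 b0 h2 cc1 p2)).
    by apply: filterS nr => x /andP[x0 xc]; rewrite /= in_itv/= xc ltW.
  apply: filterS nr => x xc; rewrite f2// ltrDl.
  case/andP: xc => xc x1.
  have xA : `[c, 1]%classic x by rewrite /= in_itv/= x1 ltW.
  have /andP[q0 _] := chart_ge0 h2 xA.
  by rewrite powR_gt0// lt0r q0 -p2 (chart_inj h2)// gt_eqF.
Qed.

Lemma lorenz_charts_heights (R : realType) (rho c alpha beta : R) f phi d0 d1 :
  0 < c < 1 -> 0 < alpha -> 0 < beta ->
  lorenz_charts_with rho c alpha beta f phi d0 d1 -> 0 < d0 /\ 0 < d1.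
Proof.
move=> /andP[c0 c1] a0 b0 [[/andP[d00 _] /andP[d10 _]] [h1 h2] [p1 p2] [q1 q2] _].
split.
- apply: (chart_height_gt0 d00 h1 _ _ _ p1 q1 a0).
  + by rewrite /= in_itv/= lexx ltW.
  + by rewrite /= in_itv/= lexx ltW.
  + by rewrite gt_eqF.
- apply: (chart_height_gt0 d10 h2 _ _ _ p2 q2 b0).
  + by rewrite /= in_itv/= lexx ltW.
  + by rewrite /= in_itv/= lexx ltW.
  + by rewrite lt_eqF.
Qed.

Lemma lorenz_charts_itv (R : realType) (rho c alpha beta : R) f phi d0 d1 x :
  0 < c < 1 -> 0 < alpha -> 0 < beta ->
  lorenz_charts_with rho c alpha beta f phi d0 d1 ->
  0 < x < 1 -> x != c -> 0 < f x < 1.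
Proof.
move=> /andP[c0 c1] a0 b0 [[/andP[d00 d01] /andP[d10 d11]] [h1 h2] [p1 p2] [q1 q2] [f1 f2]].
move=> /andP[x0 x1] xc; have := xc; rewrite neq_lt => /orP[xlt|xgt].
- rewrite f1; last by rewrite ltW.
  have /andP[g0 g1] : 0 < phi.1 x `^ alpha < d0.
    apply: (chart_range_lt a0 d00 h1 _ _ _ p1 q1) => //; rewrite ?gt_eqF//.
    + by rewrite /= in_itv/= !ltW.
    + by rewrite /= in_itv/= lexx ltW.
    + by rewrite /= in_itv/= lexx ltW.
  by apply/andP; split; lra.
- rewrite f2; last by rewrite xgt ltW.
  have /andP[g0 g1] : 0 < phi.2 x `^ beta < d1.
    apply: (chart_range_lt b0 d10 h2 _ _ _ p2 q2) => //; rewrite ?lt_eqF//.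
    + by rewrite /= in_itv/= !ltW.
    + by rewrite /= in_itv/= lexx ltW.
    + by rewrite /= in_itv/= lexx ltW.
  by apply/andP; split; lra.
Qed.

Lemma lorenz_charts_bounds (R : realType) (rho c alpha beta : R) f phi d0 d1 :
  0 < c < 1 -> 0 < alpha -> 0 < beta ->
  lorenz_charts_with rho c alpha beta f phi d0 d1 ->
  [/\ forall x, lorenz_dom c x -> 0 <= f x <= 1, f 0 = 0 & f 1 = 1].
Proof.
move=> c01 a0 b0 H; have := H; case/andP: (c01) => c0 c1.
move=> [[/andP[d00 d01] /andP[d10 d11]] [h1 h2] [p1 p2] [q1 q2] [f1 f2]].
have fz : f 0 = 0 by rewrite f1 ?lexx// q1 powRVK// subrr.
have fo : f 1 = 1 by rewrite f2 ?lexx ?andbT// q2 powRVK// subrK.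
split => // x [/=]; rewrite in_itv/= => /andP[x0 x1] /eqP xc.
have [->|xn0] := eqVneq x 0; first by rewrite fz lexx ler01.
have [->|xn1] := eqVneq x 1; first by rewrite fo lexx ler01.
have /andP[? ?] : 0 < f x < 1.
  by apply: (lorenz_charts_itv c01 a0 b0 H) => //; rewrite lt0r xn0 x0 lt_neqAle xn1.
by rewrite !ltW.
Qed.

(** * Orbits of the one-sided limits, and the metric *)

Lemma lorenz_increasing (R : realType) (rho c : R) f x y :
  expanding_lorenz rho c f -> 0 <= x -> x < y -> y <= 1 ->
  (y < c) || (c < x) -> f x < f y.
Proof.
move=> [_ [fd _] _ [sigma s1 fs] _] x0 xy y1 side.
have := lorenz_expand fd fs x0 xy y1 side.
have : 0 < sigma * (y - x) by rewrite mulr_gt0 ?subr_gt0// (lt_trans ltr01).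
by move=> h1 h2; rewrite -subr_gt0 (lt_le_trans h1).
Qed.

Lemma extend_left_itv (R : realType) (rho c alpha beta : R) f phi d0 d1 y :
  0 < c < 1 -> 0 < alpha -> 0 < beta ->
  lorenz_charts_with rho c alpha beta f phi d0 d1 ->
  0 < y <= 1 -> 0 < extend c d0 f y <= 1.
Proof.
move=> c01 a0 b0 H /andP[y0 y1].
have [d0gt _] := lorenz_charts_heights c01 a0 b0 H.
have [_ _ f1] := lorenz_charts_bounds c01 a0 b0 H.
rewrite /extend; case: ifPn => [_|yc].
  by rewrite d0gt; case: H => -[/andP[]].
have [->|yn1] := eqVneq y 1; first by rewrite f1 ltr01 lexx.
have /andP[-> /ltW ->] // : 0 < f y < 1.
by apply: (lorenz_charts_itv c01 a0 b0 H); rewrite // y0 lt_neqAle yn1.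
Qed.

Lemma iter_leftE (R : realType) (rho c alpha beta : R) f phi d0 d1 n :
  0 < c < 1 -> 0 < alpha -> 0 < beta -> expanding_lorenz rho c f ->
  lorenz_charts_with rho c alpha beta f phi d0 d1 ->
  iter_left c f n = iter n (extend c d0 f) c.
Proof.
move=> c01 a0 b0 hf H.
have [flim _] := lorenz_charts_lim c01 a0 b0 H.
apply: iter_at_left; last by case/andP: c01 => -> /ltW.
- by move=> y; exact: (extend_left_itv c01 a0 b0 H).
- move=> y /andP[y0 y1]; rewrite /extend; case: ifPn => [/eqP -> //|yc].
  have yA : lorenz_dom c y.
    by split; [rewrite /= in_itv/= y1 ltW|exact/eqP].
  have side := near_at_left_side c y0.
  have sideA : \forall x \near y^'-, lorenz_dom c x.
    apply: filterS side => x [x0 xy h].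
    split; first by rewrite /= in_itv/= !ltW// (lt_le_trans xy).
    by move=> /= xc; move: h; rewrite xc ltxx orbF -xc leNgt xy.
  apply: cvg_to_at_left.
    apply: cvg_within_at_left sideA; apply: derivable_on_continuous.
    by case: hf => _ [fd _] _ _ _; exact: fd.
  apply: filterS side => x [x0 xy h].
  apply: (lorenz_increasing hf) => //; first exact: ltW.
  by move: h; rewrite [y <= c]le_eqVlt (negbTE yc).
Qed.

Lemma iter_rightE (R : realType) (rho c alpha beta : R) f phi d0 d1 n :
  0 < c < 1 -> 0 < alpha -> 0 < beta -> expanding_lorenz rho c f ->
  lorenz_charts_with rho c alpha beta f phi d0 d1 ->
  iter_right c f n = iter n (extend c (1 - d1) f) c.
Proof.
move=> c01 a0 b0 hf H.
have [_ d1gt] := lorenz_charts_heights c01 a0 b0 H.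
have [f01 f0 _] := lorenz_charts_bounds c01 a0 b0 H.
have [_ flim] := lorenz_charts_lim c01 a0 b0 H.
have d1le : d1 <= 1 by case: H => -[_ /andP[]].
apply: iter_at_right; last by case/andP: c01 => /ltW ->.
- move=> y /andP[y0 y1]; rewrite /extend; case: ifPn => [_|yc].
    by apply/andP; split; lra.
  have [->|yn0] := eqVneq y 0; first by rewrite f0 ltr01 lexx.
  have /andP[/ltW -> ->] // : 0 < f y < 1.
  by apply: (lorenz_charts_itv c01 a0 b0 H); rewrite // y1 lt0r yn0 y0.
- move=> y /andP[y0 y1]; rewrite /extend; case: ifPn => [/eqP -> //|yc].
  have yA : lorenz_dom c y.
    by split; [rewrite /= in_itv/= y0 ltW|exact/eqP].
  have side := near_at_right_side c y1.
  have sideA : \forall x \near y^'+, lorenz_dom c x.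
    apply: filterS side => x [yx x1 h].
    split; first by rewrite /= in_itv/= !ltW// (le_lt_trans y0).
    by move=> /= xc; move: h; rewrite xc ltxx/= -xc leNgt yx.
  apply: cvg_to_at_right.
    apply: cvg_within_at_right sideA; apply: derivable_on_continuous.
    by case: hf => _ [fd _] _ _ _; exact: fd.
  apply: filterS side => x [yx x1 h].
  apply: (lorenz_increasing hf) => //; first exact: ltW.
  by move: h; rewrite [c <= y]le_eqVlt eq_sym (negbTE yc).
Qed.

Lemma lorenz_charts_unique (R : realType) (rho c alpha beta : R) f phi psi
    d0 d1 e0 e1 : 0 < c < 1 -> 0 < alpha -> 0 < beta ->
  lorenz_charts_with rho c alpha beta f phi d0 d1 ->
  lorenz_charts_with rho c alpha beta f psi e0 e1 ->
  (forall x, `[0, c]%classic x -> phi.1 x = psi.1 x) /\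
  (forall x, `[c, 1]%classic x -> phi.2 x = psi.2 x).
Proof.
move=> c01 a0 b0 H K.
have [Hl Hr] := lorenz_charts_lim c01 a0 b0 H.
have [Kl Kr] := lorenz_charts_lim c01 a0 b0 K.
have nb (x : R) : x^'- --> x by exact: cvg_within.
have nb' (x : R) : x^'+ --> x by exact: cvg_within.
have ed0 : d0 = e0.
  exact: (cvg_unique (@Rhausdorff R) (cvg_trans Hl (nb _)) (cvg_trans Kl (nb _))).
have ed1 : 1 - d1 = 1 - e1.
  exact: (cvg_unique (@Rhausdorff R) (cvg_trans Hr (nb' _)) (cvg_trans Kr (nb' _))).
case: H => _ [h1 h2] [p1 p2] _ [f1 f2]; case: K => _ [k1 k2] [q1 q2] _ [g1 g2].
split => x; rewrite /= in_itv/= => /andP[x0 x1].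
- have [->|xc] := eqVneq x c; first by rewrite p1 q1.
  have xA : `[0, c]%classic x by rewrite /= in_itv/= x0.
  have /andP[? _] := chart_ge0 h1 xA; have /andP[? _] := chart_ge0 k1 xA.
  have xlt : 0 <= x < c by rewrite x0 lt_neqAle xc.
  have := f1 _ xlt; rewrite g1// -ed0 => /addrI /oppr_inj.
  by move/(powR_injective a0) => -> //; rewrite ?nnegrE.
- have [->|xc] := eqVneq x c; first by rewrite p2 q2.
  have xA : `[c, 1]%classic x by rewrite /= in_itv/= x0.
  have /andP[? _] := chart_ge0 h2 xA; have /andP[? _] := chart_ge0 k2 xA.
  have xlt : c < x <= 1 by rewrite x1 lt_neqAle eq_sym xc x0.
  have := f2 _ xlt; rewrite g2// -ed1 => /addrI.
  by move/(powR_injective b0) => -> //; rewrite ?nnegrE.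
Qed.

(** The distance may be computed with any charts, since charts are unique on
    their intervals. *)
Lemma lorenz_dist_charts (R : realType) (rho c alpha beta : R) f g phi psi
    d0 d1 e0 e1 : 0 < c < 1 -> 0 < alpha -> 0 < beta ->
  lorenz_charts_with rho c alpha beta f phi d0 d1 ->
  lorenz_charts_with rho c alpha beta g psi e0 e1 ->
  (lorenz_dist rho c alpha beta f g =
    (`|d0 - e0|)%:E + (`|(1 - d1) - (1 - e1)|)%:E +
    C1holder_norm rho `[0%R, c] (fun x => phi.1 x - psi.1 x)%R +
    C1holder_norm rho `[c, 1%R] (fun x => phi.2 x - psi.2 x)%R)%E.
Proof.
move=> c01 a0 b0 H K.
have lim1 h chi t0 t1 : lorenz_charts_with rho c alpha beta h chi t0 t1 ->
    iter_left c h 1 = t0 /\ iter_right c h 1 = 1 - t1.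
  move=> /(lorenz_charts_lim c01 a0 b0)[hl hr].
  split; apply: cvg_lim => //; [apply: cvg_trans hl _|apply: cvg_trans hr _]; exact: cvg_within.
have uniq h chi t0 t1 : lorenz_charts_with rho c alpha beta h chi t0 t1 ->
    (forall x, `[0, c]%classic x -> (charts rho c alpha beta h).1 x = chi.1 x) /\
    (forall x, `[c, 1]%classic x -> (charts rho c alpha beta h).2 x = chi.2 x).
  move=> Hh; have [s0 [s1 Hs]] : lorenz_charts rho c alpha beta h (charts rho c alpha beta h).
    by apply: (@xgetPex _ _ [set phi | lorenz_charts rho c alpha beta h phi]); exists chi, t0, t1.
  exact: (lorenz_charts_unique c01 a0 b0 Hs Hh).
rewrite /lorenz_dist.
have [-> ->] := lim1 _ _ _ _ H; have [-> ->] := lim1 _ _ _ _ K.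
have [u1 u2] := uniq _ _ _ _ H; have [v1 v2] := uniq _ _ _ _ K.
congr (_ + _ + _)%E.
- by apply: C1holder_norm_eq => x xA; rewrite u1 ?v1.
- by apply: C1holder_norm_eq => x xA; rewrite u2 ?v2.
Qed.

(** * Perturbed maps are expanding *)

(** Adding a [C^{1+rho}] function on a part [S] of [A] that contains a
    neighbourhood of [x] in [A]. *)
Lemma derive_on_perturb (R : realType) (rho : R) (A S : set R)
    (f g e e' : R -> R) (B x : R) :
  0 < rho -> ProperFilter (within A x^') -> A x -> S x ->
  (\forall y \near x, A y -> S y) ->
  (forall y, A y -> S y -> g y = f y + e y) ->
  derivable_on A f x -> C1bound rho S e e' B ->
  derivable_on A g x /\ derive_on A g x = derive_on A f x + e' x.
Proof.
move=> r0 pf Ax Sx AS gE fd eB.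
have he : (fun y => (e y - e x) / (y - x)) @ within A x^' --> e' x.
  move=> P /(C1bound_cvg r0 eB Sx) /= h.
  by apply: (@filterS2 _ (nbhs x) _ _ _ _ _ AS h) => y Ay + yx yA; apply => //; exact: Ay.
have hg : (fun y => (g y - g x) / (y - x)) @ within A x^' --> derive_on A f x + e' x.
  apply: cvg_trans (cvgD fd he); apply: near_eq_cvg.
  apply: (@filterS _ (nbhs x) _ _ _ _ AS) => y Ay yx yA /=.
  rewrite !gE//; last by exact: Ay.
  transitivity ((f y - f x) / (y - x) + (e y - e x) / (y - x)) => //; ring.
by split; [apply/cvg_ex; eexists; exact: hg|exact: cvg_lim hg].
Qed.

(** Adding a function of small [C^{1+rho}] norm to each branch of an expanding
    Lorenz map keeps it expanding, provided that the fixed points and the range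
    are preserved. *)
Lemma expanding_lorenz_perturb (R : realType) (rho c : R) (f : R -> R) :
  0 < rho -> 0 < c < 1 -> expanding_lorenz rho c f ->
  exists2 eta : R, 0 < eta & forall g e1 e1' e2 e2' : R -> R,
    C1bound rho `[0, c] e1 e1' eta -> C1bound rho `[c, 1] e2 e2' eta ->
    (forall x : R, 0 <= x < c -> g x = f x + e1 x) ->
    (forall x : R, c < x <= 1 -> g x = f x + e2 x) ->
    (forall x, lorenz_dom c x -> 0 <= g x <= 1) -> g 0 = 0 -> g 1 = 1 ->
    expanding_lorenz rho c g.
Proof.
move=> r0 /andP[c0 c1] [_ [fd fH] _ [sigma s1 fs] [fl fr]].
exists ((sigma - 1) / 2) => [|g e1 e1' e2 e2' h1 h2 g1 g2 g01 gz go]; first by lra.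
set eta := (sigma - 1) / 2 in h1 h2 *.
set A := lorenz_dom c in fd fH fs fl fr g01 *.
have Al x : A x -> x < c -> `[0, c]%classic x.
  by move=> [] /=; rewrite !in_itv/= => /andP[-> _] _ /ltW.
have Ar x : A x -> c < x -> `[c, 1]%classic x.
  by move=> [] /=; rewrite !in_itv/= => /andP[_ ->] _ /ltW ->.
have gl x : A x -> `[0, c]%classic x -> g x = f x + e1 x.
  move=> [/= _ xc]; rewrite in_itv/= => /andP[x0 xle]; apply: g1.
  by rewrite x0 lt_neqAle xle andbT; apply/eqP.
have gr x : A x -> `[c, 1]%classic x -> g x = f x + e2 x.
  move=> [/= _ xc]; rewrite in_itv/= => /andP[xge x1']; apply: g2.
  by rewrite x1' andbT lt_neqAle xge andbT eq_sym; apply/eqP.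
have dl x : A x -> x < c -> derivable_on A g x /\ derive_on A g x = derive_on A f x + e1' x.
  move=> Ax xc; apply: (derive_on_perturb r0 _ Ax (Al _ Ax xc) _ gl (fd _ Ax) h1).
    have /andP[x0 x1] : 0 <= x <= 1 by case: Ax; rewrite /= in_itv.
    apply: (@within_dnbhs_proper _ A 0 ((x + c) / 2)); first by lra.
      by apply/andP; split; lra.
    by apply: lorenz_dom_itv; rewrite ?lexx//; [|apply/orP; left]; lra.
  by apply: filterS (lt_nbhsl xc) => y yc Ay; exact: Al.
have dr x : A x -> c < x -> derivable_on A g x /\ derive_on A g x = derive_on A f x + e2' x.
  move=> Ax xc; apply: (derive_on_perturb r0 _ Ax (Ar _ Ax xc) _ gr (fd _ Ax) h2).
    have /andP[x0 x1] : 0 <= x <= 1 by case: Ax; rewrite /= in_itv.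
    apply: (@within_dnbhs_proper _ A ((x + c) / 2) 1); first by lra.
      by apply/andP; split; lra.
    by apply: lorenz_dom_itv; rewrite ?lexx//; [|apply/orP; right]; lra.
  by apply: filterS (lt_nbhsr xc) => y yc Ay; exact: Ar.
have side x : A x -> x < c \/ c < x.
  by move=> [_ /eqP]; rewrite neq_lt => /orP.
have dge x : A x -> derivable_on A g x /\ derive_on A f x - eta <= derive_on A g x.
  move=> Ax; have [xc|xc] := side _ Ax.
  - have [? ->] := dl _ Ax xc; split => //.
    case: h1 => _ /(_ _ (Al _ Ax xc)); rewrite ler_norml => /andP[? _] _; lra.
  - have [? ->] := dr _ Ax xc; split => //.
    case: h2 => _ /(_ _ (Ar _ Ax xc)); rewrite ler_norml => /andP[? _] _; lra.
split => //.
- split => [x /dge[]//|x Ax].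
  have [K hK] := fH x Ax; exists (K + 2 * eta).
  have [xc|xc] := side _ Ax.
  + have hN : \forall y & z \near nbhs x, y < c /\ z < c.
      exists ([set y | y < c], [set z | z < c]); first by split; exact: lt_nbhsl.
      by move=> [y z] [].
    apply: (@filterS2 _ (filter_prod (nbhs x) (nbhs x)) _ _ _ _ _ hK hN) => -[y z] /= hyz [yc zc] Ay Az.
    rewrite (dl _ Ay yc).2 (dl _ Az zc).2 opprD addrACA.
    apply: le_trans (ler_normD _ _) _; rewrite mulrDl lerD ?hyz//.
    exact: C1bound_deriv_holder h1 (Al _ Ay yc) (Al _ Az zc).
  + have hN : \forall y & z \near nbhs x, c < y /\ c < z.
      exists ([set y | c < y], [set z | c < z]); first by split; exact: lt_nbhsr.
      by move=> [y z] [].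
    apply: (@filterS2 _ (filter_prod (nbhs x) (nbhs x)) _ _ _ _ _ hK hN) => -[y z] /= hyz [yc zc] Ay Az.
    rewrite (dr _ Ay yc).2 (dr _ Az zc).2 opprD addrACA.
    apply: le_trans (ler_normD _ _) _; rewrite mulrDl lerD ?hyz//.
    exact: C1bound_deriv_holder h2 (Ar _ Ay yc) (Ar _ Az zc).
- exists (sigma - eta) => [|x Ax]; first by rewrite /eta; lra.
  by apply: le_trans (dge _ Ax).2; rewrite lerD2r fs.
- split.
  + apply/cvgryPge => M; have h : \forall x \near c^'-, M + eta <= derive_on A f x.
      by move/cvgryPge : fl; apply.
    apply: filterS2 (near_at_left_side c c0) h => x [x0 xc _] hM.
    have Ax : A x.
      split; last by move=> /= e; rewrite e ltxx in xc.
      by rewrite /= in_itv/= !ltW// (lt_trans xc).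
    by apply: le_trans (dge _ Ax).2; rewrite lerBrDr.
  + apply/cvgryPge => M; have h : \forall x \near c^'+, M + eta <= derive_on A f x.
      by move/cvgryPge : fr; apply.
    apply: filterS2 (near_at_right_side c c1) h => x [xc x1 _] hM.
    have Ax : A x.
      split; last by move=> /= e; rewrite e ltxx in xc.
      by rewrite /= in_itv/= !ltW// (lt_trans c0).
    by apply: le_trans (dge _ Ax).2; rewrite lerBrDr.
Qed.

Lemma within_continuous_at (R : realType) (A : set R) (f : R -> R) (x : R) :
  nbhs x A -> derivable_on A f x -> {for x, continuous f}.
Proof.
move=> nA /derivable_on_continuous fx P /fx h.
by apply: (@filterS2 _ (nbhs x) _ _ _ _ _ nA h) => y Ay; exact.
Qed.

Lemma C1bounded_continuous_at (R : realType) (rho : R) (e : R -> R) (a b x : R) :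
  0 < rho -> C1bounded rho `[a, b] e -> a < x < b -> {for x, continuous e}.
Proof.
move=> r0 [e' [B hB]] /andP[ax xb]; have ab := lt_trans ax xb.
have xab : x \in `]a, b[ by rewrite in_itv/= ax.
apply: (@within_continuous_at _ `[a, b]).
  by apply: filterS (near_in_itvoo xab) => y; exact: subset_itv_oo_cc.
have [+ _] := C1bound_C1holder_on r0 ab hB; apply.
exact: subset_itv_oo_cc.
Qed.

Lemma continuous_near_eq (R : realType) (f g : R -> R) (x : R) :
  (\forall y \near x, f y = g y) -> {for x, continuous f} -> {for x, continuous g}.
Proof.
move=> fg fc; have h : g @ x --> f x.
  by apply: cvg_trans fc; apply: near_eq_cvg; apply: filterS fg => y ->.
by move: h; rewrite (nbhs_singleton fg).
Qed.

(** Whether an orbit reaches [c] does not depend on the value of the map at [c]. *)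
Lemma iter_hits_eq (R : realType) (h F : R -> R) (c x : R) n :
  (forall y, y != c -> h y = F y) -> iter n h x = c ->
  exists n', iter n' F x = c.
Proof.
move=> hF; elim: n x => [|n IH] x; first by exists 0%N.
rewrite iterSr; have [-> _|xc] := eqVneq x c; first by exists 0%N.
by move=> /IH[n' h']; exists n'.+1; rewrite iterSr -hF.
Qed.

(** * Density *)

Lemma C1bound0 (R : realType) (rho eta : R) (A : set R) : 0 <= eta ->
  C1bound rho A (fun=> 0) (fun=> 0) eta.
Proof. by move=> h; apply: C1bound_le (C1bound_cst rho A 0); rewrite normr0. Qed.

(** A small perturbation of the right branch makes [c_+] periodic, without
    changing [f] to the left of [c] or at the points of [L]. *)
Lemma perturb_right (R : realType) (rho c alpha beta eps : R) (f : R -> R)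
    (phi : (R -> R) * (R -> R)) (d0 d1 : R) (L : seq R) :
  0 < rho < 1 -> 0 < c < 1 -> 0 < alpha < 1 -> 0 < beta < 1 ->
  expanding_lorenz rho c f ->
  lorenz_charts_with rho c alpha beta f phi d0 d1 ->
  (forall x, x \in L -> c < x <= 1) -> 0 < eps ->
  exists (g psi : R -> R) (s : R),
  [/\ expanding_lorenz rho c g,
      lorenz_charts_with rho c alpha beta g (phi.1, psi) d0 (d1 - s),
      0 < s <= eps,
      (C1holder_norm rho `[c, 1%R] (fun x => (phi.2 x - psi x)%R) <= eps%:E)%E &
      [/\ forall x, x < c -> g x = f x, forall x, x \in L -> g x = f x &
      exists n, iter n.+1 (extend c (1 - (d1 - s)) g) c = c]].
Proof.
move=> /andP[r0 r1] c01 /andP[a0 a1] b01 hf H L1 eps0.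
have b0 : 0 < beta by case/andP: b01.
have [c0 c1] : 0 < c /\ c < 1 by apply/andP.
have [d0gt d1gt] := lorenz_charts_heights c01 a0 b0 H.
have := H => -[[d0b /andP[d1ge d1le]] [h1 h2] [p1 p2] [q1 q2] [f1 f2]].
have cc1 : `[c, 1]%classic c by rewrite /= in_itv/= lexx ltW.
have [|||w|m [[m_ge0 m0 mL mU] [e' [B hB]] hm]] :=
    perturb_chart (L := [seq phi.2 x | x <- L]) _ b01 _ _ h2.
- by rewrite r0 ltW.
- by rewrite c1/= lerDr ltW.
- by rewrite d1gt.
- move=> /mapP[x /L1 /andP[cx x1] ->].
  have xA : `[c, 1]%classic x by rewrite /= in_itv/= x1 ltW.
  have /andP[q0 _] := chart_ge0 h2 xA.
  by rewrite lt0r q0 -p2 (chart_inj h2)// gt_eqF.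
have B0 := C1bound_ge0 cc1 hB.
have [eta eta0 hexp] := expanding_lorenz_perturb r0 c01 hf.
have [s1 s10 hs] := hm eps eps0.
(* [s * B] bounds the added function, which [eta] must dominate *)
pose s0 := Num.min s1 (Num.min eps (eta / (B + 1))).
have s00 : 0 < s0 by rewrite !lt_min s10 eps0 divr_gt0//; lra.
pose G s x := if c < x then f x + s * m (phi.2 x) else f x.
have ss s : 0 < s <= s0 -> [/\ 0 <= s <= s1, s <= eps & s * B <= eta].
  move=> /andP[sgt]; rewrite !le_min => /and3P[-> -> h]; split=> //; first by rewrite ltW.
  move: h; rewrite ler_pdivlMr; last by lra.
  by apply: le_trans; rewrite ler_wpM2l ?(ltW sgt)//; lra.
have hG s : 0 < s <= s0 -> exists psi,
    [/\ expanding_lorenz rho c (G s),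
        lorenz_charts_with rho c alpha beta (G s) (phi.1, psi) d0 (d1 - s) &
        (C1holder_norm rho `[c, 1%R] (fun x => (phi.2 x - psi x)%R) <= eps%:E)%E].
  move=> sin; have [sin1 seps sB] := ss _ sin; have sgt : 0 < s by case/andP: sin.
  have [sd [psi [k1 k2 k3 k4 k5]]] := hs s sin1.
  have K : lorenz_charts_with rho c alpha beta (G s) (phi.1, psi) d0 (d1 - s).
    split => //.
    - by split => //; apply/andP; split; lra.
    - by split => //=; apply: k3.
    - by split => //=; apply: k4.
    - split => x /=; first by rewrite /G => /[dup] /andP[_ xc] /f1 ->; rewrite ltNge (ltW xc).
      move=> /[dup] /andP[xc x1] xx; rewrite /G xc f2// k2; last by rewrite x1 ltW.
      by ring.
  exists psi; split => //.
  have [g01 gz go] := lorenz_charts_bounds c01 a0 b0 K.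
  have hB' : C1bound rho `[c, 1] (fun x => s * m (phi.2 x)) (fun x => s * e' x) eta.
    by apply: C1bound_le (C1boundZ s hB); rewrite gtr0_norm.
  apply: (hexp _ _ _ _ _ (C1bound0 rho `[0, c] (ltW eta0)) hB') => //.
  - by move=> x /andP[_ xc]; rewrite /G ltNge (ltW xc) addr0.
  - by move=> x /andP[xc _]; rewrite /G xc.
pose M x := if c < x then m (phi.2 x) else 0.
have GE s x : G s x = f x + s * M x.
  by rewrite /G /M; case: ifP; rewrite ?mulr0 ?addr0.
have s0s0 : 0 < s0 <= s0 by rewrite s00 lexx.
have [psi0 [[_ [gd _] _ [sigma sig1 gs] _] _ _]] := hG s0 s0s0.
have [||||||s [n [sin hit]]] := @exists_param_hits_right R c sigma (1 - d1) s0 f M s00 sig1.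
- move=> x x01 xc; apply: (within_continuous_at (nbhs_lorenz_dom x01 xc)).
  by case: hf => _ [fd _] _ _ _; apply: fd; exact: nbhs_singleton (nbhs_lorenz_dom x01 xc).
- move=> x /andP[x0 x1]; rewrite neq_lt => /orP[xc|xc].
    apply: (@continuous_near_eq _ (fun=> 0)); last exact: cst_continuous.
    by apply: filterS (lt_nbhsl xc) => y yc; rewrite /M ltNge (ltW yc).
  apply: (@continuous_near_eq _ (fun y => m (phi.2 y))).
    by apply: filterS (lt_nbhsr xc) => y yc; rewrite /M yc.
  by apply: (C1bounded_continuous_at r0 (a := c) (b := 1)); [exists e', B|rewrite xc].
- by move=> x _ _; rewrite /M; case: ifP.
- move=> s sin; have [sin1 _ _] := ss _ sin; have [sd _] := hs s sin1.
  by case/andP: sin => ? _; apply/andP; split; lra.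
- move=> s x sin x01 xc; have [psi [_ K _]] := hG s sin.
  by rewrite -GE; exact: (lorenz_charts_itv c01 a0 b0 K).
- move=> x y x0 xy y1 side; rewrite -!GE.
  by apply: (lorenz_expand gd gs _ _ _ side) => //; exact: ltW.
have [psi [hGs K Kn]] := hG s sin; have [_ seps _] := ss _ sin.
exists (G s), psi, s; split => //; first by case/andP: sin => ->.
split.
- by move=> x xc; rewrite /G ltNge (ltW xc).
- move=> x xL; have /andP[cx _] := L1 _ xL.
  by rewrite /G cx mL ?mulr0 ?addr0//; apply/mapP; exists x.
have [|n' hn'] := iter_hits_eq (F := extend c (1 - (d1 - s)) (G s)) _ hit.
  by move=> y yc; rewrite /extend (negbTE yc) GE.
exists n'; rewrite iterSr {2}/extend eqxx.
by rewrite (_ : 1 - (d1 - s) = 1 - d1 + s) ?[X in iter _ (extend _ X _)](_ : _ = 1 - (d1 - s))//; ring.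
Qed.

(** A small perturbation of the left branch makes [c_-] periodic. *)
Lemma perturb_left (R : realType) (rho c alpha beta eps : R) (f : R -> R)
    (phi : (R -> R) * (R -> R)) (d0 d1 : R) :
  0 < rho < 1 -> 0 < c < 1 -> 0 < alpha < 1 -> 0 < beta < 1 ->
  expanding_lorenz rho c f ->
  lorenz_charts_with rho c alpha beta f phi d0 d1 -> 0 < eps ->
  exists (g psi : R -> R) (s : R),
  [/\ expanding_lorenz rho c g,
      lorenz_charts_with rho c alpha beta g (psi, phi.2) (d0 - s) d1,
      0 < s <= eps,
      (C1holder_norm rho `[0%R, c] (fun x => (phi.1 x - psi x)%R) <= eps%:E)%E &
      exists n, iter n.+1 (extend c (d0 - s) g) c = c].
Proof.
move=> /andP[r0 r1] c01 a01 /andP[b0 b1] hf H eps0.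
have a0 : 0 < alpha by case/andP: a01.
have [c0 c1] : 0 < c /\ c < 1 by apply/andP.
have [d0gt d1gt] := lorenz_charts_heights c01 a0 b0 H.
have := H => -[[/andP[d0ge d0le] d1b] [h1 h2] [p1 p2] [q1 q2] [f1 f2]].
have cc1 : `[0, c]%classic c by rewrite /= in_itv/= lexx ltW.
have [|||//|m [[m_ge0 m0 _ mU] [e' [B hB]] hm]] :=
    perturb_chart (L := [::]) _ a01 _ _ h1.
- by rewrite r0 ltW.
- by rewrite c0/= add0r ltW.
- by rewrite d0gt.
have B0 := C1bound_ge0 cc1 hB.
have [eta eta0 hexp] := expanding_lorenz_perturb r0 c01 hf.
have [s1 s10 hs] := hm eps eps0.
(* [s * B] bounds the added function, which [eta] must dominate *)
pose s0 := Num.min s1 (Num.min eps (eta / (B + 1))).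
have s00 : 0 < s0 by rewrite !lt_min s10 eps0 divr_gt0//; lra.
pose G s x := if x < c then f x - s * m (phi.1 x) else f x.
have ss s : 0 < s <= s0 -> [/\ 0 <= s <= s1, s <= eps & s * B <= eta].
  move=> /andP[sgt]; rewrite !le_min => /and3P[-> -> h]; split=> //; first by rewrite ltW.
  move: h; rewrite ler_pdivlMr; last by lra.
  by apply: le_trans; rewrite ler_wpM2l ?(ltW sgt)//; lra.
have hG s : 0 < s <= s0 -> exists psi,
    [/\ expanding_lorenz rho c (G s),
        lorenz_charts_with rho c alpha beta (G s) (psi, phi.2) (d0 - s) d1 &
        (C1holder_norm rho `[0%R, c] (fun x => (phi.1 x - psi x)%R) <= eps%:E)%E].
  move=> sin; have [sin1 seps sB] := ss _ sin; have sgt : 0 < s by case/andP: sin.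
  have [sd [psi [k1 k2 k3 k4 k5]]] := hs s sin1.
  have K : lorenz_charts_with rho c alpha beta (G s) (psi, phi.2) (d0 - s) d1.
    split => //.
    - by split => //; apply/andP; split; lra.
    - by split => //=; apply: k3.
    - by split => //=; apply: k4.
    - split => x /=; last by rewrite /G => /[dup] /andP[xc _] /f2 ->; rewrite ltNge (ltW xc).
      move=> /[dup] /andP[x0 xc] xx; rewrite /G xc f1// k2; last by rewrite x0 ltW.
      by ring.
  exists psi; split => //.
  have [g01 gz go] := lorenz_charts_bounds c01 a0 b0 K.
  have hB' : C1bound rho `[0, c] (fun x => - s * m (phi.1 x)) (fun x => - s * e' x) eta.
    by apply: C1bound_le (C1boundZ (- s) hB); rewrite normrN gtr0_norm.
  apply: (hexp _ _ _ _ _ hB' (C1bound0 rho `[c, 1] (ltW eta0))) => //.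
  - by move=> x /andP[_ xc]; rewrite /G xc mulNr.
  - by move=> x /andP[xc _]; rewrite /G ltNge (ltW xc) addr0.
pose M x := if x < c then m (phi.1 x) else 0.
have GE s x : G s x = f x - s * M x.
  by rewrite /G /M; case: ifP; rewrite ?mulr0 ?subr0.
have s0s0 : 0 < s0 <= s0 by rewrite s00 lexx.
have [psi0 [[_ [gd _] _ [sigma sig1 gs] _] _ _]] := hG s0 s0s0.
have [||||||s [n [sin hit]]] := @exists_param_hits_left R c sigma d0 s0 f M s00 sig1.
- move=> x x01 xc; apply: (within_continuous_at (nbhs_lorenz_dom x01 xc)).
  by case: hf => _ [fd _] _ _ _; apply: fd; exact: nbhs_singleton (nbhs_lorenz_dom x01 xc).
- move=> x /andP[x0 x1]; rewrite neq_lt => /orP[xc|xc].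
    apply: (@continuous_near_eq _ (fun y => m (phi.1 y))).
      by apply: filterS (lt_nbhsl xc) => y yc; rewrite /M yc.
    by apply: (C1bounded_continuous_at r0 (a := 0) (b := c)); [exists e', B|rewrite x0].
  apply: (@continuous_near_eq _ (fun=> 0)); last exact: cst_continuous.
  by apply: filterS (lt_nbhsr xc) => y yc; rewrite /M ltNge (ltW yc).
- by move=> x _ _; rewrite /M; case: ifP.
- move=> s sin; have [sin1 _ _] := ss _ sin; have [sd _] := hs s sin1.
  by case/andP: sin => ? _; apply/andP; split; lra.
- move=> s x sin x01 xc; have [psi [_ K _]] := hG s sin.
  by rewrite -GE; exact: (lorenz_charts_itv c01 a0 b0 K).
- move=> x y x0 xy y1 side; rewrite -!GE.
  by apply: (lorenz_expand gd gs _ _ _ side) => //; exact: ltW.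
have [psi [hGs K Kn]] := hG s sin; have [_ seps _] := ss _ sin.
exists (G s), psi, s; split => //; first by case/andP: sin => ->.
have [|n' hn'] := iter_hits_eq (F := extend c (d0 - s) (G s)) _ hit.
  by move=> y yc; rewrite /extend (negbTE yc) GE.
by exists n'; rewrite iterSr {2}/extend eqxx.
Qed.

(** A finite set misses some interval to the right of [c]. *)
Lemma exists_right_gap (R : realType) (c : R) (l : seq R) :
  exists2 r, 0 < r & forall x, x \in l -> ~ (c < x < c + r).
Proof.
elim: l => [|y l [r r0 hr]]; first by exists 1.
have [yc|cy] := leP y c.
  exists r => // x; rewrite in_cons => /orP[/eqP -> /andP[]|/hr//].
  by rewrite ltNge yc.
exists (Num.min r (y - c)); first by rewrite lt_min r0 subr_gt0.
move=> x; rewrite in_cons => /orP[/eqP ->|/hr h] /andP[cx].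
  by rewrite addr_minr lt_min => /andP[_]; rewrite addrC subrK ltxx.
by rewrite addr_minr lt_min => /andP[xr _]; apply: h; rewrite cx.
Qed.

Theorem mainTheorem2 (R : realType) (rho c alpha beta : R)
    (hrho : 0 < rho < 1) (hc : 0 < c < 1)
    (halpha : 0 < alpha < 1) (hbeta : 0 < beta < 1) :
  forall f : R -> R, lorenz_maps rho c alpha beta f ->
  forall eps : R, 0 < eps ->
  exists2 g : R -> R, lorenz_D rho c alpha beta g &
    (lorenz_dist rho c alpha beta f g < eps%:E)%E.
Proof.
move=> f [hf [phi [d0 [d1 H]]]] eps eps0.
have a0 : 0 < alpha by case/andP: halpha.
have b0 : 0 < beta by case/andP: hbeta.
have del0 : 0 < eps / 8 by lra.
have [g1 [psi1 [s1 [hg1 H1 /andP[s10 s1e] n1 [n hn]]]]] :=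
  perturb_left hrho hc halpha hbeta hf H del0.
pose F := extend c (d0 - s1) g1.
pose orb := traject F c n.+1.
have orbP k : iter k F c \in orb.
  by apply/loopingP; rewrite /looping hn mem_head.
(* the points of the orbit of [c_-] at which the second bump must vanish *)
pose L := [seq x <- orb | c < x <= 1].
have [|g2 [psi2 [s2 [hg2 H2 /andP[s20 s2e] n2 [gl gL [t ht]]]]]] :=
  perturb_right (L := L) hrho hc halpha hbeta hg1 H1 _ del0.
  by move=> x; rewrite mem_filter => /andP[].
have orb01 k : 0 < iter k F c <= 1.
  elim: k => [|k IH]; first by case/andP: hc => /= -> /ltW.
  exact: (extend_left_itv hc a0 b0 H1).
(* the second perturbation fixes the values of the map along the orbit of [c_-] *)
have orb_eq k : iter k (extend c (d0 - s1) g2) c = iter k F c.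
  elim: k => // k IH; rewrite !iterS IH; have := orbP k; have := orb01 k.
  move: (iter k F c) => y /andP[_ y1] yorb; rewrite /F /extend.
  case: ifPn => //; rewrite neq_lt => /orP[/gl//|cy]; apply: gL.
  by rewrite mem_filter yorb cy y1.
have [r r0 hr] := exists_right_gap c orb.
exists g2.
  split; first by split => //; do 3 eexists; exact: H2.
  exists t.+1, r; split => //.
    by rewrite (iter_rightE _ hc a0 b0 hg2 H2).
  move=> k _; rewrite (iter_leftE _ hc a0 b0 hg2 H2) /= orb_eq.
  exact: hr.
rewrite (lorenz_dist_charts hc a0 b0 H H2) /=.
have le4 (a b u v : \bar R) : (a <= (eps / 8)%:E -> b <= (eps / 8)%:E ->
    u <= (eps / 8)%:E -> v <= (eps / 8)%:E -> a + b + u + v < eps%:E)%E.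
  move=> ha hb hu hv; apply: (@le_lt_trans _ _ ((eps / 8)%:E + (eps / 8)%:E + (eps / 8)%:E + (eps / 8)%:E)%E).
    by rewrite !leeD.
  by rewrite -!EFinD lte_fin; lra.
apply: le4 => //; rewrite lee_fin.
- by rewrite opprB addrC subrK gtr0_norm.
- by rewrite (_ : _ - _ = - s2) ?normrN ?gtr0_norm//; ring.
Qed.
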